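(* Let $c:\mathcal U\to(0,\infty)$ be an arbitrary control cost function. For $i\in\{0,\dots,M-1\}$ write $$d_i^* \triangleq \max_{q(\cdot|\cdot)}\ \frac{\min_{j\ne i}\ \sum_{\tilde y\in\mathcal Y,\,u\in\mathcal U}\mu_i^q(\tilde y)\,q(u|\tilde y)\,D\big(p_i^u(\cdot|\tilde y)\,\|\,p_j^u(\cdot|\tilde y)\big)}{\sum_{\tilde y\in\mathcal Y,\,u\in\mathcal U}\mu_i^q(\tilde y)\,q(u|\tilde y)\,c(u)},$$ the maximum being over all conditional pmfs $q(u|\tilde y)$, $u\in\mathcal U$, $\tilde y\in\mathcal Y$. (Converse.) Any sequence of sequential tests $(\phi,N,\delta)$ with vanishing maximal probability of error, $P_{\max}\to 0$, satisfies for every $i=0,\dots,M-1$ $$\mathbb E_i\Big[\sum_{k=1}^N c(U_k)\Big]\ \ge\ \frac{-\log R_i}{d_i^*}\,(1+o(1))\ \ge\ \frac{-\log P_{\max}}{d_i^*}\,(1+o(1)).$$ (Achievability.) Consider the test $(\phi^*,N^*,\delta^* )$ with threshold $T>0$ described in the context, with exploration parameter $a>1$ sufficiently close to $1$, and let $P^*_{\max}$, $R^*_0,\dots,R^*_{M-1}$ be its maximal error probability and risks. Then $$P^*_{\max}\le \frac{M-1}{T}.$$ Furthermore, the test is asymptotically optimal: as $T\to\infty$, for each $i=0,\dots,M-1$, $$\mathbb E_i\Big[\sum_{k=1}^{N^*} c(U_k)\Big]=\frac{-\log P^*_{\max}}{d_i^*}(1+o(1))=\Big(\inf_{(\phi,N,\delta)\in\mathbb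 C(P^*_{\max})}\mathbb E_i\Big[\sum_{k=1}^{N} c(U_k)\Big]\Big)(1+o(1))$$ $$=\frac{-\log R^*_i}{d_i^*}(1+o(1))=\Big(\inf_{(\phi,N,\delta)\in\mathbb C'(R^*_0,\dots,R^*_{M-1})}\mathbb E_i\Big[\sum_{k=1}^{N} c(U_k)\Big]\Big)(1+o(1)).$$
   Context: Observation model. $\mathcal Y$ (observations) and $\mathcal U$ (controls) are finite sets; there are $M$ hypotheses $0,\dots,M-1$. For each hypothesis $i$ and $u\in\mathcal U$, $p_i^u(\cdot|\cdot)$ is a given transition probability from $\mathcal Y$ to itself, and $p_i^u(y|\tilde y)>0$ for all $i,u,y,\tilde y$. The initial observation $y_0$ is a constant. Under hypothesis $i$, conditioned on $(u_k,y_{k-1})$, the observation $Y_k$ is conditionally independent of all earlier observations and controls $(y^{k-2},u^{k-1})$ and has distribution $p_i^{u_k}(\cdot|y_{k-1})$, $k=1,2,\dots$. Here $y^k=(y_1,\dots,y_k)$, $u^k=(u_1,\dots,u_k)$. Policies and tests. A causal control policy $\phi$ is a collection of conditional pmfs $q_1(u_1|y_0)$ and $q_k(u_k|y^{k-1},u^{k-1})$, $k\ge2$, specifying the (randomized) control $U_k$. Under hypothesis $i$ the joint pmf is $$p_i(y^n,u^n)=q_1(u_1|y_0)\prod_{k=1}^n p_i^{u_k}(y_k|y_{k-1})\prod_{k=2}^n q_k(u_k|y^{k-1},u^{k-1}).$$ $\mathbb P_i,\mathbb E_i$ denote probability and expectation under hypothesis $i$. A sequential test $(\phi,N,\delta)$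 consists of a causal control policy $\phi$, a stopping time $N$ with respect to $\mathcal F_k=\sigma(Y^k,U^k)$, and a decision rule $\delta=\delta(Y^N,U^N)\in\{0,\dots,M-1\}$. Error criteria. $P_{\max}=\max_i\mathbb P_i\{\delta\ne i\}$; the risks are $R_i=\max_{j\ne i}\mathbb P_j\{\delta=i\}$. $\mathbb C(\alpha)$ is the class of tests with $P_{\max}\le\alpha$, and $\mathbb C'(\beta_0,\dots,\beta_{M-1})$ the class of tests with $R_i\le\beta_i$ for all $i$. $D(p_1\|p_2)=\sum_y p_1(y)\log\frac{p_1(y)}{p_2(y)}$ is the Kullback–Leibler distance. Stationary distributions. For a conditional pmf $q(u|\tilde y)$, $\mu_i^q$ is the unique stationary distribution of the transition probabilities $p_i^q(y|\tilde y)=\sum_{u}q(u|\tilde y)p_i^u(y|\tilde y)$ on $\mathcal Y$. The test $(\phi^*,N^*,\delta^* )$. For each $i$ let $q_i^*(\cdot|\cdot)$ be a conditional pmf attaining the maximum in the definition of $d_i^*$ (see the claim). Let $\hat i_n=\operatorname{argmax}_{i}p_i(Y^n,U^n)$ be the maximum likelihood (ML) estimate of the hypothesis. The policy $\phi^*$: at times $k=\lceil a^\ell\rceil$, $\ell=0,1,2,\dots$, $U_k$ is uniformly distributed on $\mathcal U$, independently of all past observations and controls; at all other times $U_k\sim q^*_{\hat i_{k-1}}(\cdot|y_{k-1})$. Here $a>1$ is a fixed constant chosen sufficiently close to $1$. The stopping time is $$N^*=\min\Big\{n\ge1:\ \frac{p_{\hat i_n}(Y^n,U^n)}{\max_{j\ne\hat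 i_n}p_j(Y^n,U^n)}>T\Big\},$$ and $\delta^*=\hat i_{N^*}$. *)

(* Defs.v *)
From HB Require Import structures.
From mathcomp Require Import all_boot all_order all_algebra.
From mathcomp Require Import all_classical all_reals all_analysis.

Set Implicit Arguments.
Unset Strict Implicit.
Unset Printing Implicit Defensive.

Import Order.TTheory GRing.Theory Num.Theory.
Import numFieldNormedType.Exports.

Local Open Scope classical_set_scope.
Local Open Scope ring_scope.

Definition is_pmf {R : realType} {A : finType} (f : A -> R) : Prop :=
  (forall a, 0 <= f a) /\ \sum_a f a = 1.

Definition KL {R : realType} {A : finType} (f g : A -> R) : R :=
  \sum_a f a * ln (f a / g a).

Section Model.
Context {R : realType} {M : nat} {Y U : finType}.

(* A history is the chronological list [:: (y_1, u_1); ...; (y_k, u_k)]. *)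
Definition history := seq (Y * U).

(* [phi h u] is q_(k+1)(u | y^k, u^k) for the history h = (y^k, u^k); the
   constant y_0 is not recorded, so [phi [::]] is q_1(. | y_0). *)
Definition policy := history -> U -> R.

Definition is_policy (phi : policy) : Prop := forall h, is_pmf (phi h).

(* One probability space carrying the processes (Y_k)_(k >= 1) and
   (U_k)_(k >= 1) together with the probabilities P_0, ..., P_(M-1).
   The values at index 0 are irrelevant. *)
Record experiment := Experiment {
  exp_display : measure_display;
  Omega : measurableType exp_display;
  Pr : 'I_M -> probability Omega R;
  obs : nat -> Omega -> Y;
  ctl : nat -> Omega -> U }.

Definition hist (X : experiment) (k : nat) (w : Omega X) : history :=
  [seq (obs m w, ctl m w) | m <- iota 1 k].

(* F_k = sigma(Y^k, U^k): since (Y^k, U^k) takes finitely many values, the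
   preimages of all sets of histories already form the sigma-algebra. *)
Definition filtration (X : experiment) (k : nat) : set_system (Omega X) :=
  preimage_set_system setT (@hist X k) setT.

(* [stop w = None] means N = oo.  The decision is a function of the history
   (Y^N, U^N) observed up to the stopping time. *)
Record seqtest := Seqtest {
  pol : policy;
  expt : experiment;
  stop : Omega expt -> option nat;
  rule : history -> 'I_M }.

Definition decision (t : seqtest) (w : Omega (expt t)) : option 'I_M :=
  omap (fun n => rule t (hist n w)) (stop w).

(* P_i{delta <> j} never counts the event N = oo, on which no decision is
   made; on that event the cost below is infinite. *)
Definition Pmax (t : seqtest) : \bar R :=
  \big[maxe/0%E]_(i < M)
    Pr (expt t) i [set w | exists2 j, decision w = Some j & j != i].

Definition risk (t : seqtest) (i : 'I_M) : \bar R :=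
  \big[maxe/0%E]_(j < M | j != i) Pr (expt t) j [set w | decision w = Some i].

Definition not_after (k : nat) (n : option nat) : bool :=
  if n is Some n' then (k <= n')%N else true.

(* E_i[c(U_1) + ... + c(U_N)], with the infinite series when N = oo. *)
Definition expected_cost (c : U -> R) (t : seqtest) (i : 'I_M) : \bar R :=
  (\int[Pr (expt t) i]_w
     \sum_(1 <= k <oo | not_after k (stop w)) (c (ctl k w))%:E)%E.

Variables (y0 : Y).
(* [p i u yt y] is p_i^u(y | yt). *)
Variable p : 'I_M -> U -> Y -> Y -> R.

Definition last_obs (h : history) : Y := last y0 [seq x.1 | x <- h].

Definition joint (phi : policy) (i : 'I_M) (h : history) : R :=
  (\prod_(k < size h)
     p i (tnth (in_tuple h) k).2 (last_obs (take k h)) (tnth (in_tuple h) k).1) *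
  (\prod_(k < size h) phi (take k h) (tnth (in_tuple h) k).2).

Definition realizes (phi : policy) (X : experiment) : Prop :=
  [/\ forall k y, measurable [set w : Omega X | obs k w = y],
      forall k u, measurable [set w : Omega X | ctl k w = u] &
      forall i h, Pr X i [set w | hist (size h) w = h] = (joint phi i h)%:E].

Definition is_seqtest (t : seqtest) : Prop :=
  [/\ is_policy (pol t), realizes (pol t) (expt t) &
      forall n, filtration n [set w : Omega (expt t) | stop w = Some n]].

(* The classes C(alpha) and C'(beta_0, ..., beta_(M-1)); they are predicates
   because [seqtest] is too large a type to be the carrier of a [set]. *)
Definition class_Pmax (alpha : \bar R) (t : seqtest) : Prop :=
  is_seqtest t /\ (Pmax t <= alpha)%E.

Definition class_risk (beta : 'I_M -> \bar R) (t : seqtest) : Prop :=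
  is_seqtest t /\ forall i, (risk t i <= beta i)%E.

Definition inf_cost (c : U -> R) (i : 'I_M) (C : seqtest -> Prop) : \bar R :=
  ereal_inf [set v | exists2 t, C t & v = expected_cost c t i].

(* Conditional pmfs q(u | yt), written [q yt u]. *)
Definition is_cpmf (q : Y -> U -> R) : Prop := forall yt, is_pmf (q yt).

Definition mixed_trans (i : 'I_M) (q : Y -> U -> R) (yt y : Y) : R :=
  \sum_u q yt u * p i u yt y.

Definition stationary (i : 'I_M) (q : Y -> U -> R) (m : {ffun Y -> R}) : Prop :=
  is_pmf m /\ forall y, \sum_yt m yt * mixed_trans i q yt y = m y.

Definition mu (i : 'I_M) (q : Y -> U -> R) : {ffun Y -> R} :=
  xget [ffun=> 0] [set m | stationary i q m].

Definition info_rate (i j : 'I_M) (q : Y -> U -> R) : R :=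
  \sum_yt \sum_u mu i q yt * q yt u * KL (p i u yt) (p j u yt).

Definition cost_rate (c : U -> R) (i : 'I_M) (q : Y -> U -> R) : R :=
  \sum_yt \sum_u mu i q yt * q yt u * c u.

(* The infimum is over a finite set, nonempty as soon as M >= 2. *)
Definition reward (c : U -> R) (i : 'I_M) (q : Y -> U -> R) : R :=
  inf [set info_rate i j q | j in [set j | j != i]] / cost_rate c i q.

(* d_i^*; the supremum is a maximum by compactness.  It is 0 exactly when some
   other hypothesis has the same kernels as i; dividing the positive extended
   real - log P by it then gives +oo (see [inve]), like the cost itself. *)
Definition dstar (c : U -> R) (i : 'I_M) : R :=
  sup [set reward c i q | q in is_cpmf].

Definition is_maximizer (c : U -> R) (i : 'I_M) (q : Y -> U -> R) : Prop :=
  is_cpmf q /\ forall q', is_cpmf q' -> reward c i q' <= reward c i q.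

Definition is_ML (phi : policy) (ihat : history -> 'I_M) : Prop :=
  forall h i, joint phi i h <= joint phi (ihat h) h.

Definition exploration_time (a : R) (k : nat) : Prop :=
  exists l : nat, k%:Z = Num.ceil (a ^+ l).

(* The likelihoods entering the ML estimate at time k-1 involve the policy only
   up to time k-1, so the equations below determine phi^* recursively.  Ties in
   the argmax are broken by [ihat], and k = 1 is always an exploration time. *)
Definition is_star_policy (a : R) (qs : 'I_M -> Y -> U -> R)
    (ihat : history -> 'I_M) (phi : policy) : Prop :=
  is_ML phi ihat /\
  forall h u,
    (exploration_time a (size h).+1 -> phi h u = #|U|%:R^-1) /\
    (~ exploration_time a (size h).+1 -> phi h u = qs (ihat h) (last_obs h) u).

Definition crosses (T : R) (ihat : history -> 'I_M) (phi : policy)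
    (h : history) : bool :=
  T < joint phi (ihat h) h / \big[Num.max/0]_(j < M | j != ihat h) joint phi j h.

Definition first_time (P : pred nat) : option nat :=
  if pselect (exists n, P n) is left exP then Some (ex_minn exP) else None.

Definition star_test (ihat : history -> 'I_M) (phi : policy) (X : experiment)
    (T : R) : seqtest :=
  @Seqtest phi X
    (fun w => first_time (fun n => (0 < n)%N && crosses T ihat phi (hist n w)))
    ihat.

End Model.

Arguments experiment : clear implicits.
Arguments seqtest : clear implicits.

(* f = g (1 + o(1)) along the filter F. *)
Definition asym_eq {R : realType} {I : Type} (F : set_system I)
    (f g : I -> \bar R) : Prop :=
  exists2 e : I -> R, e @ F --> (0 : R) &
    \forall x \near F, f x = (g x * (1 + e x)%:E)%E.

(* Main.v *)
Require Import Defs.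
From HB Require Import structures.
From mathcomp Require Import all_boot all_order all_algebra.
From mathcomp Require Import all_classical all_reals all_analysis.
From mathcomp Require Import measurable_realfun.
From mathcomp Require Import ring lra.

Set Implicit Arguments.
Unset Strict Implicit.
Unset Printing Implicit Defensive.

Import Order.TTheory GRing.Theory Num.Theory.
Import numFieldNormedType.Exports.

Local Open Scope classical_set_scope.
Local Open Scope ring_scope.

(** All probabilities are reduced to finite sums over histories of a fixed length:
    under hypothesis [i] the law of the first [n] observations and controls is
    [joint], and [Ex] is the corresponding expectation.

    Converse. Stop a test at a fixed time [n] at the latest. The mean under [i] of
    the log-likelihood ratio of [i] to [j] is the sum over states and controls of
    the occupation measure of the running test times the divergence of the kernels
    ([Ex_stopped], [occupation_sum]), and a change of measure to [j] shows that it
    is at least [(1 - error) (- ln risk) - 1] up to the probability of not having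
    stopped by [n] ([tree_converse]). On the other side, the occupation measure is
    stationary up to a defect of total mass 2, whatever the test
    ([occupation_defect]). Positive kernels contract the l1-norm of centred
    vectors, so this measure is within a constant of a multiple of the stationary
    law of its own conditional control law, and the definition of [dstar] provides
    a rival [j] for which the accumulated information is at most [dstar] times the
    expected cost plus a constant ([dstar_occupation]). The result is
    [(1 - error) (- ln risk) <= dstar * cost + K] with [K] the same for all tests
    ([converse_bound]). When [dstar = 0] another hypothesis has the same kernels,
    and a test with small errors has infinite cost.

    Achievability. The error bound is a change of measure to the hypothesis that is
    wrongly decided ([star_wrong_decision]). For the cost under [i], the mean of
    the square root of the likelihood ratio of [j] to [i] loses a fixed factor
    at each exploration time; as these times grow like [a ^ l] with [a] close
    to 1, the expected number of misestimations is finite ([misestimation_sum]).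
    At the other times the control follows the maximizing law, and the solution of
    the Poisson equation turns the log-likelihood ratio minus [dstar - eps] times
    the cost into a process with positive drift, whose negative part is summable in
    mean ([rate_deficit], [positive_drift_deficit]). Just before stopping some
    rival is not yet rejected, so [(dstar - eps) * cost] is at most [ln T] plus
    remainders of bounded mean ([star_cost_sum]). Since [- ln Pmax] is at least
    [ln T - ln (M - 1)], this upper bound and [converse_bound], applied to the test
    itself and to all its competitors, give the four asymptotic equalities
    ([star_optimal]). *)

(** * Expectations over finite histories *)

Section HistorySums.
Context {T : finType}.

Lemma big_history_rcons (V : Type) (idx : V) (op : Monoid.law idx)
    (G : seq T -> T -> V) (h : seq T) (x : T) :
  \big[op/idx]_(k < size (rcons h x))
     G (take k (rcons h x)) (tnth (in_tuple (rcons h x)) k) =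
  op (\big[op/idx]_(k < size h) G (take k h) (tnth (in_tuple h) k)) (G h x).
Proof.
have E (s : seq T) : \big[op/idx]_(k < size s) G (take k s) (tnth (in_tuple s) k)
    = \big[op/idx]_(k < size s) G (take k s) (nth x s k).
  by apply: eq_bigr => k _; rewrite (tnth_nth x).
rewrite !E size_rcons big_ord_recr /=; congr (op _ _).
  apply: eq_bigr => k _; rewrite nth_rcons ltn_ord; congr (G _ _).
  by rewrite -cats1 takel_cat // ltnW.
by rewrite nth_rcons ltnn eqxx -cats1 take_size_cat.
Qed.

Lemma big_tuple_rcons (V : nmodType) (n : nat) (F : seq T -> V) :
  \sum_(t : n.+1.-tuple T) F t =
  \sum_(t : n.-tuple T) \sum_(x : T) F (rcons t x).
Proof.
rewrite pair_big /=.
pose ext (tx : n.-tuple T * T) : n.+1.-tuple T := [tuple of rcons tx.1 tx.2].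
have ext_inj : injective ext.
  move=> [t x] [t' x'] /(congr1 val) /= /rcons_inj [tt' xx'].
  by congr pair => //; apply: val_inj.
rewrite (reindex ext) //; apply: onW_bij; apply: inj_card_bij => //.
by rewrite card_prod !card_tuple expnSr.
Qed.

End HistorySums.

Section Tree.
Context {R : realType} {M : nat} {Y U : finType} {y0 : Y}
  {p : 'I_M -> U -> Y -> Y -> R}.
Implicit Types (phi : @policy R Y U) (h : @history Y U) (f : @history Y U -> R).
Context (hp : forall i u yt, is_pmf (p i u yt)).
Context (hpos : forall i u yt y, 0 < p i u yt y).

Local Notation joint := (joint y0 p).
Local Notation last_obs := (last_obs y0).

Lemma last_obs_rcons h x : last_obs (rcons h x) = x.1.
Proof. by rewrite /Defs.last_obs map_rcons last_rcons. Qed.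

Lemma joint_nil phi i : joint phi i [::] = 1.
Proof. by rewrite /Defs.joint !big_ord0 mulr1. Qed.

Lemma joint_rcons phi i h y u :
  joint phi i (rcons h (y, u)) = joint phi i h * (phi h u * p i u (last_obs h) y).
Proof.
rewrite /Defs.joint
  (big_history_rcons _ (fun h x => p i x.2 (last_obs h) x.1))
  (big_history_rcons _ (fun h x => phi h x.2)) /=.
ring.
Qed.

Lemma joint_ge0 phi i h : is_policy phi -> 0 <= joint phi i h.
Proof.
move=> hphi; apply: mulr_ge0; apply: prodr_ge0 => k _; first exact: ltW.
by have [] := hphi (take k h).
Qed.

Lemma joint_take_gt0 phi i h k : is_policy phi ->
  0 < joint phi i h -> 0 < joint phi i (take k h).
Proof.
move=> hphi; elim/last_ind: h => [|h [y u] IH] //.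
rewrite joint_rcons => J.
have Jh : 0 < joint phi i h.
  rewrite lt0r joint_ge0 // andbT; apply/eqP => E; move: J.
  by rewrite E mul0r ltxx.
have [kh|hk] := leqP k (size h); first by rewrite -cats1 takel_cat ?IH.
by rewrite take_oversize ?joint_rcons ?size_rcons.
Qed.

(** The expectation of [f] of the first [n] observations and controls under
    hypothesis [i]; the law of a history is [joint], so it is a finite sum. *)
Definition Ex phi i n f : R :=
  \sum_(t : n.-tuple (Y * U)) joint phi i t * f t.

(** The conditional mean of [f] one step later, given the history [h]. *)
Definition step_mean phi i f h : R :=
  \sum_u phi h u * \sum_y p i u (last_obs h) y * f (rcons h (y, u)).

Lemma Ex0 phi i f : Ex phi i 0 f = f [::].
Proof.
rewrite /Ex (big_pred1 [tuple]) => [|t]; first by rewrite joint_nil mul1r.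
by rewrite /= [t]tuple0; apply/esym/eqP/val_inj.
Qed.

Lemma ExS phi i n f : Ex phi i n.+1 f = Ex phi i n (step_mean phi i f).
Proof.
rewrite /Ex (big_tuple_rcons n (fun h => joint phi i h * f h)).
apply: eq_bigr => t _.
transitivity (\sum_y \sum_u joint phi i (rcons t (y, u)) * f (rcons t (y, u))).
  by rewrite pair_bigA; apply: eq_bigr => -[y u].
rewrite exchange_big /step_mean mulr_sumr; apply: eq_bigr => u _.
rewrite !mulr_sumr; apply: eq_bigr => y _; rewrite joint_rcons; ring.
Qed.

Lemma eq_Ex phi i n f g :
  (forall h, size h = n -> f h = g h) -> Ex phi i n f = Ex phi i n g.
Proof. by move=> E; apply: eq_bigr => t _; rewrite E ?size_tuple. Qed.

Lemma ExD phi i n f g :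
  Ex phi i n (fun h => f h + g h) = Ex phi i n f + Ex phi i n g.
Proof. by rewrite -big_split; apply: eq_bigr => t _; rewrite mulrDr. Qed.

Lemma ExZ phi i n a f : Ex phi i n (fun h => a * f h) = a * Ex phi i n f.
Proof. by rewrite mulr_sumr; apply: eq_bigr => t _; rewrite mulrCA. Qed.

Lemma ExN phi i n f : Ex phi i n (fun h => - f h) = - Ex phi i n f.
Proof. by rewrite -sumrN; apply: eq_bigr => t _; rewrite mulrN. Qed.

Lemma ExB phi i n f g :
  Ex phi i n (fun h => f h - g h) = Ex phi i n f - Ex phi i n g.
Proof. by rewrite ExD ExN. Qed.

Lemma Ex_sum phi i n (I : Type) (r : seq I) (P : pred I) (F : I -> @history Y U -> R) :
  Ex phi i n (fun h => \sum_(a <- r | P a) F a h) =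
  \sum_(a <- r | P a) Ex phi i n (F a).
Proof. by rewrite exchange_big; apply: eq_bigr => t _; rewrite mulr_sumr. Qed.

Lemma le_Ex phi i n f g : is_policy phi ->
  (forall h, size h = n -> 0 < joint phi i h -> f h <= g h) ->
  Ex phi i n f <= Ex phi i n g.
Proof.
move=> hphi fg; apply: ler_sum => t _.
have := joint_ge0 i t hphi; rewrite le0r => /orP[/eqP ->|J]; first by rewrite !mul0r.
by rewrite ler_pM2l // fg ?size_tuple.
Qed.

Lemma Ex_ge0 phi i n f : is_policy phi ->
  (forall h, size h = n -> 0 <= f h) -> 0 <= Ex phi i n f.
Proof.
by move=> hphi f0; apply: sumr_ge0 => t _; rewrite mulr_ge0 ?joint_ge0 ?f0 ?size_tuple.
Qed.

Lemma step_mean_cst phi i a h : is_policy phi -> step_mean phi i (fun=> a) h = a.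
Proof.
move=> hphi; rewrite /step_mean.
under eq_bigr do rewrite -mulr_suml (hp _ _ _).2 mul1r.
by rewrite -mulr_suml (hphi h).2 mul1r.
Qed.

Lemma Ex_cst phi i n a : is_policy phi -> Ex phi i n (fun=> a) = a.
Proof.
move=> hphi; elim: n => [|n IH]; first by rewrite Ex0.
by rewrite ExS -[RHS]IH; apply: eq_Ex => h _; rewrite step_mean_cst.
Qed.

Lemma Ex_take phi i n m f : is_policy phi -> (m <= n)%N ->
  Ex phi i n (fun h => f (take m h)) = Ex phi i m f.
Proof.
move=> hphi; elim: n => [|n IH]; first by rewrite leqn0 => /eqP ->; apply: eq_Ex => h /size0nil ->.
rewrite leq_eqVlt => /orP[/eqP -> | mn].
  by apply: eq_Ex => h sh; rewrite take_oversize // sh.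
rewrite -(IH mn) ExS; apply: eq_Ex => h sh.
rewrite -[RHS](step_mean_cst i _ h hphi) /step_mean; apply: eq_bigr => u _; congr (_ * _).
by apply: eq_bigr => y _; rewrite -cats1 takel_cat ?sh.
Qed.

Definition drift phi i f h : R := step_mean phi i f h - f h.

Context (st : pred (@history Y U)).

Definition alive h := all (fun k => ~~ st (take k h)) (iota 0 (size h).+1).

(** If no prefix satisfies [st], [find] returns [size h + 1] and [take] gives [h]. *)
Definition stopped h := take (find (fun k => st (take k h)) (iota 0 (size h).+1)) h.

Lemma alive_rcons h x : alive (rcons h x) = alive h && ~~ st (rcons h x).
Proof.
have -> : alive (rcons h x) = all (fun k => ~~ st (take k (rcons h x)))
    (iota 0 (size h).+1) && ~~ st (rcons h x).
  rewrite {1}/alive size_rcons -(addn1 (size h).+1) iotaD all_cat add0n /= andbT.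
  by rewrite (@take_oversize _ (size h).+1) // size_rcons.
congr (_ && _).
apply: eq_in_all => k; rewrite mem_iota /= add0n => kh.
by rewrite -cats1 takel_cat.
Qed.

Lemma aliveP h : reflect (forall k, (k <= size h)%N -> ~~ st (take k h)) (alive h).
Proof.
apply: (iffP allP) => A k; last by rewrite mem_iota /= add0n => /A.
by move=> kh; apply: A; rewrite mem_iota /= add0n.
Qed.

Lemma stopped_alive h : alive h -> stopped h = h.
Proof.
rewrite /alive all_predC has_find size_iota -leqNgt => F.
by rewrite /stopped take_oversize // (leq_trans _ F).
Qed.

Lemma stopped_stop h : ~~ alive h ->
  exists k, [/\ (k <= size h)%N, stopped h = take k h, st (take k h) &
    forall m, (m < k)%N -> ~~ st (take m h)].
Proof.
rewrite /alive all_predC negbK => H.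
have H' := H; rewrite has_find size_iota in H'.
exists (find (fun k => st (take k h)) (iota 0 (size h).+1)); split => //.
- have := nth_find 0%N H; rewrite nth_iota // add0n; exact.
- move=> m mk; have := before_find 0%N mk; rewrite nth_iota ?add0n => [->//|].
  exact: ltn_trans mk H'.
Qed.

Lemma stopped_rcons h x :
  stopped (rcons h x) = if alive h then rcons h x else stopped h.
Proof.
case: ifPn => [ah|].
  have [ahx|] := boolP (alive (rcons h x)); first by rewrite stopped_alive.
  move=> /stopped_stop[k [kh -> sk _]]; move: kh; rewrite size_rcons leq_eqVlt.
  case/orP => [/eqP ->|kh]; first by rewrite take_oversize ?size_rcons.
  move: sk; rewrite -cats1 takel_cat //.
  by rewrite (negPf (aliveP _ ah k _)).
move=> nah.
have nahx : ~~ alive (rcons h x) by rewrite alive_rcons (negPf nah).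
have [k [kh -> sk mk]] := stopped_stop nah.
have [k' [kh' -> sk' mk']] := stopped_stop nahx.
have E m : (m <= size h)%N -> take m (rcons h x) = take m h.
  by move=> mh; rewrite -cats1 takel_cat.
have kk' : k = k'.
  apply/eqP; rewrite eqn_leq; apply/andP; split; rewrite leqNgt; apply/negP => L.
    by have := mk _ L; rewrite -E ?sk' // (leq_trans (ltnW L)).
  by have := mk' _ L; rewrite E ?sk.
by rewrite -kk' E.
Qed.

Lemma step_mean_stopped phi i f h : is_policy phi ->
  step_mean phi i (fun h => f (stopped h)) h =
  f (stopped h) + (alive h)%:R * drift phi i f h.
Proof.
move=> hphi; have [ah|nah] := boolP (alive h).
  rewrite mul1r stopped_alive // /drift addrC subrK /step_mean.
  by under eq_bigr do under eq_bigr do rewrite stopped_rcons ah.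
rewrite mul0r addr0 -[RHS](step_mean_cst i _ h hphi) /step_mean.
by under eq_bigr do under eq_bigr do rewrite stopped_rcons (negPf nah).
Qed.

(** Optional stopping: the stopped history moves only while [alive] holds, so
    the means of the increments telescope. *)
Lemma Ex_stopped phi i n f : is_policy phi ->
  Ex phi i n (fun h => f (stopped h)) =
  f [::] + \sum_(k < n) Ex phi i k (fun h => (alive h)%:R * drift phi i f h).
Proof.
move=> hphi; elim: n => [|n IH]; first by rewrite Ex0 big_ord0 addr0.
rewrite big_ord_recr addrA -IH -ExD /= ExS; apply: eq_Ex => h _.
exact: step_mean_stopped.
Qed.

(** Additive functionals of the history; the increment may depend on the past. *)
Definition cum (g : @history Y U -> Y * U -> R) h : R :=
  \sum_(k < size h) g (take k h) (tnth (in_tuple h) k).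

Lemma cum_nil g : cum g [::] = 0.
Proof. by rewrite /cum big_ord0. Qed.

Lemma cum_rcons g h x : cum g (rcons h x) = cum g h + g h x.
Proof. exact: big_history_rcons. Qed.

Lemma drift_cum phi i g h : is_policy phi ->
  drift phi i (cum g) h =
  \sum_u phi h u * \sum_y p i u (last_obs h) y * g h (y, u).
Proof.
move=> hphi; rewrite /drift.
have -> : step_mean phi i (cum g) h = step_mean phi i (fun=> cum g h) h +
    \sum_u phi h u * \sum_y p i u (last_obs h) y * g h (y, u).
  rewrite /step_mean -big_split; apply: eq_bigr => u _ /=; rewrite -mulrDr; congr (_ * _).
  by rewrite -big_split; apply: eq_bigr => y _ /=; rewrite cum_rcons mulrDr.
by rewrite step_mean_cst // addrC addKr.
Qed.

Definition llr i j := cum (fun h x =>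
  ln (p i x.2 (last_obs h) x.1 / p j x.2 (last_obs h) x.1)).

Lemma expR_llr_step i j u yt y :
  expR (- ln (p i u yt y / p j u yt y)) * p i u yt y = p j u yt y.
Proof.
rewrite expRN lnK ?posrE ?divr_gt0 // invf_div.
by rewrite divfK // gt_eqF.
Qed.

Lemma joint_llr phi i j h : joint phi j h = joint phi i h * expR (- llr i j h).
Proof.
elim/last_ind: h => [|h [y u] IH]; first by rewrite !joint_nil /llr cum_nil oppr0 expR0 mulr1.
rewrite !joint_rcons IH /llr cum_rcons /= opprD expRD.
rewrite -[X in _ * (_ * X) = _](expR_llr_step i j u (last_obs h) y).
ring.
Qed.

Lemma Ex_llr phi i j n f :
  Ex phi j n f = Ex phi i n (fun h => expR (- llr i j h) * f h).
Proof. by apply: eq_bigr => t _; rewrite (joint_llr phi i j) mulrA. Qed.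

Lemma step_mean_llr phi i j f h :
  step_mean phi i (fun h => expR (- llr i j h) * f h) h =
  expR (- llr i j h) * step_mean phi j f h.
Proof.
rewrite /step_mean mulr_sumr; apply: eq_bigr => u _.
rewrite mulrCA; congr (_ * _); rewrite mulr_sumr; apply: eq_bigr => y _.
rewrite /llr cum_rcons /= opprD expRD -/(llr i j).
rewrite -[X in _ = _ * (X * _)](expR_llr_step i j u (last_obs h) y); ring.
Qed.

(** The change of measure survives stopping because multiplication by
    [exp (- llr)] turns the one-step means under [j] into those under [i]. *)
Lemma Ex_stopped_llr phi i j n f : is_policy phi ->
  Ex phi j n (fun h => f (stopped h)) =
  Ex phi i n (fun h => expR (- llr i j (stopped h)) * f (stopped h)).
Proof.
move=> hphi; rewrite Ex_stopped //.
rewrite (Ex_stopped i n (fun h => expR (- llr i j h) * f h)) //.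
rewrite {1}/llr cum_nil oppr0 expR0 mul1r; congr (_ + _).
apply: eq_bigr => k _; rewrite (Ex_llr phi i j); apply: eq_Ex => h _.
by rewrite /drift step_mean_llr; ring.
Qed.

Lemma drift_llr phi i j h : is_policy phi ->
  drift phi i (llr i j) h =
  \sum_u phi h u * KL (p i u (last_obs h)) (p j u (last_obs h)).
Proof. by move=> hphi; rewrite /llr drift_cum. Qed.

End Tree.

(** * Positive stochastic kernels on a finite set *)

Section FiniteLinearSystems.
Context {R : realType} {T : finType}.
Implicit Types (G : T -> T -> R) (f v b : T -> R).

Let mx G : 'M[R]_#|T| := \matrix_(i, j) G (@enum_val T T i) (@enum_val T T j).

Lemma sum_enum_val (V : nmodType) (F : T -> V) :
  \sum_x F x = \sum_(i < #|T|) F (@enum_val T T i).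
Proof. by rewrite (reindex (@enum_val T T)) //; apply: onW_bij; apply: enum_val_bij. Qed.

Lemma left_kernel_mx G : \det (mx G) = 0 ->
  exists2 v, (exists x, v x != 0) & forall y, \sum_x v x * G x y = 0.
Proof.
move/eqP/det0P => [v v0 vG]; exists (fun x => v 0 (enum_rank x)).
  have [i vi] : exists i, v 0 i != 0.
    apply/existsP; apply: contraNT v0; rewrite negb_exists => /forallP H.
    by apply/eqP/rowP => i; rewrite mxE; apply/eqP; have := H i; rewrite negbK.
  by exists (@enum_val T T i); rewrite enum_valK.
move=> y; rewrite sum_enum_val.
transitivity ((v *m mx G) 0 (enum_rank y)); last by rewrite vG mxE.
by rewrite mxE; apply: eq_bigr => i _; rewrite mxE enum_valK enum_rankK.
Qed.

Lemma det_mx_tr G : \det (mx G) = \det (mx (fun x y => G y x)).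
Proof. by rewrite -det_tr; congr (\det _); apply/matrixP => i j; rewrite !mxE. Qed.

Lemma right_kernel_mx G : \det (mx G) = 0 ->
  exists2 f, (exists x, f x != 0) & forall x, \sum_y G x y * f y = 0.
Proof.
rewrite det_mx_tr => /left_kernel_mx[f f0 fG]; exists f => // x.
by rewrite -[RHS](fG x); apply: eq_bigr => y _; rewrite mulrC.
Qed.

(** A square matrix and its transpose are singular together. *)
Lemma left_kernel G f : (exists x, f x != 0) ->
  (forall x, \sum_y G x y * f y = 0) ->
  exists2 v, (exists x, v x != 0) & forall y, \sum_x v x * G x y = 0.
Proof.
move=> [x0 fx0] Gf; apply: left_kernel_mx; rewrite det_mx_tr; apply/eqP/det0P.
exists (\row_i f (@enum_val T T i)).
  by apply/eqP => /rowP/(_ (enum_rank x0)); rewrite !mxE enum_rankK; apply/eqP.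
apply/rowP => j; rewrite !mxE -[RHS](Gf (@enum_val T T j)) sum_enum_val.
by apply: eq_bigr => i _; rewrite !mxE mulrC.
Qed.

Lemma solvable_of_injective G :
  (forall f, (forall x, \sum_y G x y * f y = 0) -> forall x, f x = 0) ->
  forall b, exists f, forall x, \sum_y G x y * f y = b x.
Proof.
move=> inj b; have uG : mx G \in unitmx.
  rewrite unitmxE unitfE; apply/eqP => /right_kernel_mx[f [x fx] Gf].
  by move: fx; rewrite inj // eqxx.
pose bc : 'cV[R]_#|T| := \col_i b (@enum_val T T i).
exists (fun x => (invmx (mx G) *m bc) (enum_rank x) 0) => x.
have := congr1 (fun A : 'cV_#|T| => A (enum_rank x) 0) (mulKVmx uG bc).
rewrite mxE [RHS]mxE enum_rankK => <-; rewrite sum_enum_val.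
by apply: eq_bigr => i _; rewrite [mx _ _ _]mxE enum_valK enum_rankK.
Qed.

End FiniteLinearSystems.

Section PositiveKernel.
Context {R : realType} {T : finType} (K : T -> T -> R) (eta : R).
Context (x0 : T) (eta0 : 0 < eta) (Keta : forall x y, eta <= K x y)
  (K1 : forall x, \sum_y K x y = 1).
Implicit Types (m v f g : T -> R).

Let K0 x y : 0 < K x y. Proof. exact: lt_le_trans (Keta x y). Qed.

(** As [v] has total mass zero, [eta] can be subtracted from every entry of [K],
    which leaves nonnegative entries with row sums at most [1 - eta]. *)
Lemma kernel_contraction v : \sum_x v x = 0 ->
  \sum_y `|\sum_x v x * K x y| <= (1 - eta) * \sum_x `|v x|.
Proof.
move=> v0.
have step y : `|\sum_x v x * K x y| <= \sum_x `|v x| * (K x y - eta).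
  have -> : \sum_x v x * K x y = \sum_x v x * (K x y - eta).
    under [RHS]eq_bigr do rewrite mulrBr.
    by rewrite sumrB -mulr_suml v0 mul0r subr0.
  apply: le_trans (ler_norm_sum _ _ _) _; apply: ler_sum => x _.
  by rewrite normrM (ger0_norm (x := _ - eta)) // subr_ge0.
apply: le_trans (ler_sum _ (fun y _ => step y)) _.
rewrite exchange_big mulr_sumr; apply: ler_sum => x _ /=.
rewrite -mulr_sumr mulrC ler_wpM2r //.
rewrite sumrB K1 lerD2l lerN2 (bigD1 x0) //= lerDl.
by apply: sumr_ge0 => *; apply: ltW.
Qed.

(** Subtracting a multiple of [mu] does not change the defect of invariance, and
    by contraction a vector of total mass zero is controlled by its defect. *)
Lemma stationary_approx m mu (B : R) :
  \sum_x mu x = 1 -> (forall y, \sum_x mu x * K x y = mu y) ->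
  \sum_y `|\sum_x m x * K x y - m y| <= B ->
  \sum_y `|m y - (\sum_x m x) * mu y| <= B / eta.
Proof.
move=> mu1 muK mB; set A := \sum_x m x; pose v x := m x - A * mu x.
have v0 : \sum_x v x = 0 by rewrite sumrB -mulr_sumr mu1 mulr1 subrr.
have vK y : \sum_x v x * K x y = (\sum_x m x * K x y) - A * mu y.
  under eq_bigr do rewrite mulrBl -mulrA.
  by rewrite sumrB -mulr_sumr muK.
have tri y : `|v y| <= `|\sum_x m x * K x y - m y| + `|\sum_x v x * K x y|.
  rewrite vK -[X in X + _]normrN opprB; apply: le_trans (ler_normD _ _).
  by rewrite addrA subrK.
have := ler_sum (index_enum T) (fun y (_ : true) => tri y).
rewrite big_split /= => H; have := kernel_contraction v0.
rewrite ler_pdivlMr // -/(v _); lra.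
Qed.

(** Constants are right eigenvectors of [K] for the eigenvalue 1, so there is a
    left eigenvector. Its absolute value is subinvariant, and since [K] preserves
    the total mass it is invariant. *)
Lemma exists_stationary :
  exists m : T -> R, [/\ forall x, 0 <= m x, \sum_x m x = 1 &
    forall y, \sum_x m x * K x y = m y].
Proof.
pose G x y := K x y - (x == y)%:R.
have sumG v y : \sum_x v x * G x y = (\sum_x v x * K x y) - v y.
  under eq_bigr do rewrite mulrBr.
  rewrite sumrB; congr (_ - _); rewrite (bigD1 y) //= eqxx mulr1 big1 ?addr0 // => x.
  by move=> /negPf ->; rewrite mulr0.
have [|x|v [x1 vx1] vG] := @left_kernel R T G (fun=> 1).
- by exists x0; rewrite oner_neq0.
- under eq_bigr do rewrite mulr1.
  rewrite sumrB K1 (bigD1 x) //= eqxx big1 ?addr0 ?subrr // => y.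
  by rewrite eq_sym => /negPf ->.
have vK y : v y = \sum_x v x * K x y by have := vG y; rewrite sumG => /subr0_eq.
pose w x := `|v x|.
have wK y : w y <= \sum_x w x * K x y.
  rewrite /w vK; apply: le_trans (ler_norm_sum _ _ _) _; apply: ler_sum => x _.
  by rewrite normrM (gtr0_norm (K0 _ _)).
have wKe y : \sum_x w x * K x y = w y.
  apply/eqP; rewrite -subr_eq0; apply/eqP.
  apply: (@psumr_eq0P _ _ predT (fun y => \sum_x w x * K x y - w y)) => // [z _|].
    by rewrite subr_ge0.
  rewrite sumrB exchange_big /=; apply/eqP; rewrite subr_eq0; apply/eqP.
  by apply: eq_bigr => x _; rewrite -mulr_sumr K1 mulr1.
pose A := \sum_x w x.
have A0 : 0 < A.
  rewrite /A (bigD1 x1) //=; apply: ltr_pwDl; first by rewrite normr_gt0.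
  by apply: sumr_ge0 => x _; rewrite normr_ge0.
exists (fun x => w x / A); split=> [x||y].
- by rewrite divr_ge0 ?normr_ge0 // ltW.
- by rewrite -mulr_suml divff // gt_eqF.
- by under eq_bigr do rewrite mulrAC; rewrite -mulr_suml wKe.
Qed.

(** Maximum principle: the maximum of [f] is an average of all its values with
    positive weights. *)
Lemma harmonic_const f : (forall x, \sum_y K x y * f y = f x) ->
  forall x y, f x = f y.
Proof.
move=> Kf; have [z _ fz] := @arg_maxP _ _ T x0 predT f isT.
suff E y : f y = f z by move=> x y; rewrite !E.
apply/eqP; rewrite eq_sym -subr_eq0.
have : \sum_y K z y * (f z - f y) = 0.
  under eq_bigr do rewrite mulrBr.
  by rewrite sumrB Kf -mulr_suml K1 mul1r subrr.
move=> /(@psumr_eq0P _ _ predT (fun y => K z y * (f z - f y))) H.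
have {H} := H _ y isT; move/(_ _)/eqP; rewrite mulf_eq0 gt_eqF //= => -> // x _.
by rewrite mulr_ge0 ?(ltW (K0 _ _)) // subr_ge0; apply: fz.
Qed.

(** The equation below is the Poisson equation of the chain; it is solvable
    because adding the rank-one kernel [mu] to [1 - K] makes it injective:
    pairing with [mu] forces a kernel element to be harmonic and centred. *)
Lemma poisson_equation mu f :
  \sum_x mu x = 1 -> (forall y, \sum_x mu x * K x y = mu y) ->
  exists g, forall x, f x + \sum_y K x y * g y - g x = \sum_y mu y * f y.
Proof.
move=> mu1 muK; pose G x y := (x == y)%:R - K x y + mu y.
have sumG g x : \sum_y G x y * g y = g x - \sum_y K x y * g y + \sum_y mu y * g y.
  under eq_bigr do rewrite /G mulrDl mulrBl.
  rewrite big_split sumrB /=; congr (_ - _ + _).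
  rewrite (bigD1 x) //= eqxx mul1r big1 ?addr0 // => y.
  by rewrite eq_sym => /negPf ->; rewrite mul0r.
have muG g : \sum_x mu x * \sum_y G x y * g y = \sum_y mu y * g y.
  under eq_bigr do rewrite sumG mulrDr mulrBr.
  rewrite big_split sumrB /= -mulr_suml mu1 mul1r.
  suff -> : \sum_x mu x * \sum_y K x y * g y = \sum_y mu y * g y by rewrite subrr add0r.
  under eq_bigr do rewrite mulr_sumr.
  rewrite exchange_big; apply: eq_bigr => y _ /=.
  by rewrite -(muK y) mulr_suml; apply: eq_bigr => x _; rewrite mulrA.
have [g Gg] : exists g, forall x, \sum_y G x y * g y = f x.
  apply: solvable_of_injective => g Gg.
  have mug : \sum_y mu y * g y = 0.
    by rewrite -muG big1 // => x _; rewrite Gg mulr0.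
  have gc : forall x y, g x = g y.
    apply: harmonic_const => x; have := Gg x; rewrite sumG mug addr0.
    by move/subr0_eq.
  move=> x; rewrite -mug; under eq_bigr do rewrite (gc _ x).
  by rewrite -mulr_suml mu1 mul1r.
exists g => x.
have <- : \sum_y mu y * g y = \sum_y mu y * f y.
  by rewrite -muG; apply: eq_bigr => y _; rewrite Gg.
by rewrite -(Gg x) sumG; ring.
Qed.

End PositiveKernel.

(** * Information and cost rates *)

Section FiniteBounds.
Context {R : realType} {T : finType}.

Lemma fin_pos_lbound (f : T -> R) : (forall x, 0 < f x) ->
  exists2 e, 0 < e & forall x, e <= f x.
Proof.
move=> f0; exists (\big[Num.min/1]_x f x).
  by elim/big_ind: _ => // x y x0 y0; rewrite lt_min x0.
by move=> x; rewrite (bigD1 x) //= ge_min lexx.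
Qed.

Lemma fin_ubound (f : T -> R) : exists2 B, 0 < B & forall x, `|f x| <= B.
Proof.
exists (1 + \sum_x `|f x|); first by rewrite ltr_wpDr // sumr_ge0.
move=> x; rewrite (bigD1 x) //= addrCA lerDl addr_ge0 //.
by rewrite sumr_ge0.
Qed.

End FiniteBounds.

Section KullbackLeibler.
Context {R : realType} {T : finType} (f g : T -> R).
Context (hf : is_pmf f) (hg : is_pmf g) (f0 : forall x, 0 < f x) (g0 : forall x, 0 < g x).

(** The correction [f - g] has sum zero and makes every term nonnegative. *)
Let gap x := f x * ln (f x / g x) - (f x - g x).

Let gap_expR x : gap x = f x * (expR (- ln (f x / g x)) - (1 - ln (f x / g x))).
Proof.
rewrite expRN lnK ?posrE ?divr_gt0 // invf_div /gap.
have ? : f x != 0 by rewrite gt_eqF.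
by field.
Qed.

Let gap_ge0 x : 0 <= gap x.
Proof. by rewrite gap_expR mulr_ge0 ?(ltW (f0 _)) // subr_ge0 expR_ge1Dx. Qed.

Let KL_gap : KL f g = \sum_x gap x.
Proof. by rewrite !sumrB hf.2 hg.2 subrr subr0. Qed.

Lemma KL_ge0 : 0 <= KL f g.
Proof. by rewrite KL_gap; apply: sumr_ge0. Qed.

Lemma KL_eq0 : KL f g = 0 -> f =1 g.
Proof.
rewrite KL_gap => /psumr_eq0P H x; have /eqP := H (fun x _ => gap_ge0 x) x isT.
rewrite gap_expR mulf_eq0 gt_eqF //= subr_eq0.
have [l0 _|l0] := eqVneq (ln (f x / g x)) 0; last first.
  by rewrite gt_eqF // expR_gt1Dx // oppr_eq0.
have fg1 : f x / g x = 1.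
  by rewrite -expR0 -l0 lnK // posrE divr_gt0.
by rewrite -[f x](divfK (x := g x)) ?gt_eqF // fg1 mul1r.
Qed.

End KullbackLeibler.

Section Rates.
Context {R : realType} {M : nat} {Y U : finType} (y0 : Y) (u0 : U)
  (p : 'I_M -> U -> Y -> Y -> R) (c : U -> R).
Context (hM : (1 < M)%N) (hp : forall i u yt, is_pmf (p i u yt))
  (hpos : forall i u yt y, 0 < p i u yt y) (hc : forall u, 0 < c u).
Implicit Types (q : Y -> U -> R) (r : Y -> U -> R) (i j : 'I_M).

Definition rate i q r : R := \sum_yt \sum_u mu p i q yt * q yt u * r yt u.

Lemma info_rateE i j q :
  info_rate p i j q = rate i q (fun yt u => KL (p i u yt) (p j u yt)).
Proof. by []. Qed.

Lemma cost_rateE i q : cost_rate p c i q = rate i q (fun=> c).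
Proof. by []. Qed.

Lemma exists_other i : exists j, j != i.
Proof.
pose j0 : 'I_M := Ordinal (ltnW hM); pose j1 : 'I_M := Ordinal hM.
by have [->|] := eqVneq i j0; [exists j1 | exists j0; rewrite eq_sym].
Qed.

Lemma kernel_lbound : exists2 eta, 0 < eta & forall i u yt y, eta <= p i u yt y.
Proof.
have [e e0 H] := @fin_pos_lbound R _ (fun x : 'I_M * U * Y * Y =>
  p x.1.1.1 x.1.1.2 x.1.2 x.2) (fun=> hpos _ _ _ _).
by exists e => // i u yt y; apply: (H (i, u, yt, y)).
Qed.

Lemma mixed_trans_sum1 i q yt : is_cpmf q -> \sum_y mixed_trans p i q yt y = 1.
Proof.
move=> hq; rewrite exchange_big /=.
under eq_bigr do rewrite -mulr_sumr (hp _ _ _).2 mulr1.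
exact: (hq yt).2.
Qed.

Lemma mixed_trans_lbound eta i q yt y : is_cpmf q ->
  (forall i u yt y, eta <= p i u yt y) -> eta <= mixed_trans p i q yt y.
Proof.
move=> hq H; rewrite -[eta]mul1r -(hq yt).2 mulr_suml.
by apply: ler_sum => u _; rewrite ler_wpM2l // (hq yt).1.
Qed.

Lemma mu_stationary i q : is_cpmf q -> stationary p i q (mu p i q).
Proof.
move=> hq; apply: (@xgetPex _ _ [set m | stationary p i q m]).
have [eta eta0 H] := kernel_lbound.
have [m [m0 m1 mK]] := exists_stationary y0 eta0
  (fun yt y => mixed_trans_lbound i yt y hq H) (fun yt => mixed_trans_sum1 i yt hq).
exists [ffun y => m y]; split; first split => [y|]; rewrite ?ffunE //.
  by under eq_bigr do rewrite ffunE.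
by move=> y; rewrite ffunE -[RHS]mK; apply: eq_bigr => yt _; rewrite ffunE.
Qed.

Lemma mu_ge0 i q yt : is_cpmf q -> 0 <= mu p i q yt.
Proof. by move=> /(mu_stationary i)[[+ _] _]; apply. Qed.

Lemma mu_sum1 i q : is_cpmf q -> \sum_yt mu p i q yt = 1.
Proof. by move=> /(mu_stationary i)[[]]. Qed.

Lemma mu_gt0 i q yt : is_cpmf q -> 0 < mu p i q yt.
Proof.
move=> hq; have [eta eta0 H] := kernel_lbound; apply: lt_le_trans eta0 _.
rewrite -(mu_stationary i hq).2 -[eta]mul1r -(mu_sum1 i hq) mulr_suml.
by apply: ler_sum => z _; rewrite ler_wpM2l ?mu_ge0 ?mixed_trans_lbound.
Qed.

Lemma rate_le i q r r' : is_cpmf q -> (forall yt u, r yt u <= r' yt u) ->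
  rate i q r <= rate i q r'.
Proof.
move=> hq rr; apply: ler_sum => yt _; apply: ler_sum => u _.
by rewrite ler_wpM2l // mulr_ge0 ?mu_ge0 // (hq yt).1.
Qed.

Lemma rate_cst i q a : is_cpmf q -> rate i q (fun _ _ => a) = a.
Proof.
move=> hq; rewrite /rate -[RHS]mul1r -(mu_sum1 i hq) mulr_suml.
by apply: eq_bigr => yt _; rewrite -mulr_suml -mulr_sumr (hq yt).2 mulr1.
Qed.

Lemma KLp_ge0 i j u yt : 0 <= KL (p i u yt) (p j u yt).
Proof. exact: KL_ge0. Qed.

Lemma info_rate_ge0 i j q : is_cpmf q -> 0 <= info_rate p i j q.
Proof.
move=> hq; rewrite info_rateE -(rate_cst i 0 hq); apply: rate_le => // *.
exact: KLp_ge0.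
Qed.

Lemma cost_rate_gt0 i q : is_cpmf q -> 0 < cost_rate p c i q.
Proof.
move=> hq; have [e e0 He] := fin_pos_lbound hc.
apply: lt_le_trans e0 _; rewrite cost_rateE -(rate_cst i e hq).
by apply: rate_le.
Qed.

Lemma reward_le i j q : is_cpmf q -> j != i ->
  reward p c i q * cost_rate p c i q <= info_rate p i j q.
Proof.
move=> hq ji; rewrite /reward divfK ?gt_eqF ?cost_rate_gt0 //.
apply: ge_inf; last by exists j.
by exists 0 => _ [k _ <-]; apply: info_rate_ge0.
Qed.

Lemma reward_attained i q : is_cpmf q -> exists2 j, j != i &
  info_rate p i j q = reward p c i q * cost_rate p c i q.
Proof.
move=> hq; have [j0 j0i] := exists_other i.
have [j ji Hj] := @arg_minP _ _ _ j0 (fun j => j != i) (fun j => info_rate p i j q) j0i.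
exists j => //; apply/eqP; rewrite eq_le reward_le // andbT.
rewrite /reward divfK ?gt_eqF ?cost_rate_gt0 //.
apply: lb_le_inf; first by exists (info_rate p i j q), j.
by move=> _ [k ki <-]; apply: Hj.
Qed.

Lemma reward_ge0 i q : is_cpmf q -> 0 <= reward p c i q.
Proof.
move=> hq; have [j ji E] := reward_attained i hq.
by rewrite -(pmulr_lge0 _ (cost_rate_gt0 i hq)) -E info_rate_ge0.
Qed.

Lemma KL_ubound : exists2 B, 0 < B & forall i j u yt, `|KL (p i u yt) (p j u yt)| <= B.
Proof.
have [B B0 H] := @fin_ubound R _ (fun x : 'I_M * 'I_M * U * Y =>
  KL (p x.1.1.1 x.1.2 x.2) (p x.1.1.2 x.1.2 x.2)).
by exists B => // i j u yt; apply: (H (i, j, u, yt)).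
Qed.

Lemma reward_le_dstar i q : is_cpmf q -> reward p c i q <= dstar p c i.
Proof.
move=> hq; apply: ub_le_sup; last by exists q.
have [B B0 HB] := KL_ubound; have [e e0 He] := fin_pos_lbound hc.
exists (B / e) => _ [q' hq' <-]; have [j ji E] := reward_attained i hq'.
have C0 := cost_rate_gt0 i hq'.
rewrite -(ler_pM2r C0) -E; apply: (@le_trans _ _ B).
  rewrite info_rateE -(rate_cst i B hq'); apply: rate_le => // yt u.
  by apply: le_trans (ler_norm _) _.
rewrite mulrAC ler_pdivlMr // ler_pM2l // cost_rateE -(rate_cst i e hq').
exact: rate_le.
Qed.

Lemma dstar_maximizer i q : is_maximizer p c i q -> dstar p c i = reward p c i q.
Proof.
move=> [hq max]; apply/eqP; rewrite eq_le reward_le_dstar // andbT.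
apply: ge_sup; first by exists (reward p c i q), q.
by move=> _ [q' hq' <-]; apply: max.
Qed.

Let unif : Y -> U -> R := fun _ _ => #|U|%:R^-1.

Let U_gt0 : (0 < #|U|)%N. Proof. by apply/card_gt0P; exists u0. Qed.

Lemma uniform_pmf : is_pmf (fun _ : U => #|U|%:R^-1 : R).
Proof.
split=> [u|]; first by rewrite invr_ge0.
by rewrite sumr_const -[RHS](@divff _ #|U|%:R) ?mulr_natl // pnatr_eq0 -lt0n.
Qed.

Lemma uniform_cpmf : is_cpmf unif.
Proof. by move=> yt; apply: uniform_pmf. Qed.

Lemma dstar_ge0 i : 0 <= dstar p c i.
Proof. exact: le_trans (reward_ge0 i uniform_cpmf) (reward_le_dstar i uniform_cpmf). Qed.

(** Uniform controls visit every pair, so they separate [i] from every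
    hypothesis with other kernels. *)
Lemma dstar_eq0 i : dstar p c i = 0 ->
  exists2 j, j != i & forall u yt, p i u yt =1 p j u yt.
Proof.
move=> d0; have hq := uniform_cpmf.
have rw0 : reward p c i unif = 0.
  by apply/eqP; rewrite eq_le reward_ge0 // andbT -d0 reward_le_dstar.
have [j ji] := reward_attained i hq; rewrite rw0 mul0r => E; exists j => // u yt.
apply: KL_eq0 => //.
have term_ge0 z v : 0 <= mu p i unif z * unif z v * KL (p i v z) (p j v z).
  apply: mulr_ge0; last exact: KLp_ge0.
  by rewrite mulr_ge0 ?mu_ge0 // (hq z).1.
have E1 : \sum_v mu p i unif yt * unif yt v * KL (p i v yt) (p j v yt) = 0.
  by apply: (psumr_eq0P (P := predT) _ E) => // z _; apply: sumr_ge0.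
have /eqP : mu p i unif yt * unif yt u * KL (p i u yt) (p j u yt) = 0.
  by apply: (psumr_eq0P (P := predT) _ E1).
rewrite !mulf_eq0 (gt_eqF (mu_gt0 i yt hq)) /= invr_eq0 pnatr_eq0.
by rewrite -[_ == 0%N]negbK -lt0n U_gt0 /= => /eqP.
Qed.

Lemma info_rate_same i j q : (forall u yt, p i u yt =1 p j u yt) ->
  info_rate p i j q = 0.
Proof.
move=> E; rewrite /info_rate big1 // => yt _; rewrite big1 // => u _.
rewrite /KL big1 ?mulr0 // => y _.
by rewrite -E divff ?gt_eqF // ln1 mulr0.
Qed.

Lemma dstar_gt0_distinct i j q : is_maximizer p c i q -> 0 < dstar p c i -> j != i ->
  exists u yt y, p i u yt y != p j u yt y.
Proof.
move=> qmax; rewrite (dstar_maximizer qmax) => d0 ji.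
apply: contrapT => H; have [hq _] := qmax.
have : 0 < info_rate p i j q.
  by apply: lt_le_trans (reward_le hq ji); rewrite mulr_gt0 ?cost_rate_gt0.
rewrite info_rate_same ?ltxx // => u yt y; apply/eqP/negPn/negP => ne.
by apply: H; exists u, yt, y.
Qed.

(** An occupation measure that is stationary up to a bounded defect is close
    to a multiple of the stationary law of its own conditional control law:
    the l1-contraction turns the defect into a distance. *)
Lemma occupation_rate i : exists2 K, 0 < K & forall (pi : Y -> U -> R),
  (forall yt u, 0 <= pi yt u) ->
  \sum_y `|(\sum_yt \sum_u pi yt u * p i u yt y) - \sum_u pi y u| <= 2 ->
  exists2 q, is_cpmf q & forall r B, 0 <= B -> (forall yt u, `|r yt u| <= B) ->
  `|(\sum_yt \sum_u pi yt u * r yt u) -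
    (\sum_yt \sum_u pi yt u) * rate i q r| <= K * B.
Proof.
have [eta eta0 Heta] := kernel_lbound.
exists (2 / eta); first by rewrite divr_gt0.
move=> pi pi0 defect.
pose m y := \sum_u pi y u.
pose q y u := if m y == 0 then #|U|%:R^-1 else pi y u / m y.
have m0 y : 0 <= m y by apply: sumr_ge0.
have mq y u : m y * q y u = pi y u.
  rewrite /q; case: eqP => [E|/eqP E]; last by rewrite mulrCA divff ?mulr1.
  rewrite E mul0r; apply/esym/(psumr_eq0P (P := predT) _ E) => // v _; exact: pi0.
have hq : is_cpmf q.
  move=> y; have [Ey|Ey] := eqVneq (m y) 0.
    have -> : q y = fun=> #|U|%:R^-1 by apply: funext => u; rewrite /q Ey eqxx.
    exact: uniform_pmf.
  split=> [u|]; first by rewrite /q (negPf Ey) divr_ge0.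
  under eq_bigr do rewrite /q (negPf Ey).
  by rewrite -mulr_suml divff.
have mK y : \sum_yt m yt * mixed_trans p i q yt y = \sum_yt \sum_u pi yt u * p i u yt y.
  apply: eq_bigr => yt _; rewrite mulr_sumr; apply: eq_bigr => u _.
  by rewrite mulrA mq.
exists q => // r B B0 rB.
have [[mu0 mu1] muK] := mu_stationary i hq.
have := stationary_approx y0 eta0 (fun yt y => mixed_trans_lbound i yt y hq Heta)
  (fun yt => mixed_trans_sum1 i yt hq) (m := m) (B := 2) mu1 muK.
under eq_bigr do rewrite mK.
move=> /(_ defect) close.
have -> : (\sum_yt \sum_u pi yt u * r yt u) - (\sum_yt \sum_u pi yt u) * rate i q r =
  \sum_yt (m yt - (\sum_x m x) * mu p i q yt) * \sum_u q yt u * r yt u.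
  rewrite /rate mulr_sumr -sumrB; apply: eq_bigr => yt _.
  rewrite mulrBl; congr (_ - _).
    by rewrite mulr_sumr; apply: eq_bigr => u _; rewrite mulrA mq.
  rewrite -mulrA; congr (_ * _); rewrite mulr_sumr.
  by apply: eq_bigr => u _; rewrite mulrA.
apply: le_trans (ler_norm_sum _ _ _) _.
apply: le_trans (ler_wpM2r B0 close); rewrite mulr_suml.
apply: ler_sum => yt _; rewrite normrM ler_wpM2l //.
rewrite -[B]mul1r -(hq yt).2 mulr_suml; apply: le_trans (ler_norm_sum _ _ _) _.
apply: ler_sum => u _; rewrite normrM (ger0_norm ((hq yt).1 u)).
by rewrite ler_wpM2l // (hq yt).1.
Qed.

(** The rival [j] that attains the reward of the conditional control law of [pi]
    gains at most [dstar] units of information per unit of cost. *)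
Lemma dstar_occupation i : exists2 K, 0 < K & forall (pi : Y -> U -> R),
  (forall yt u, 0 <= pi yt u) ->
  \sum_y `|(\sum_yt \sum_u pi yt u * p i u yt y) - \sum_u pi y u| <= 2 ->
  exists2 j, j != i & \sum_yt \sum_u pi yt u * KL (p i u yt) (p j u yt) <=
    dstar p c i * (\sum_yt \sum_u pi yt u * c u) + K.
Proof.
have [K K0 HK] := occupation_rate i.
have [B B0 HB] := KL_ubound; have [C C0 HC] := fin_ubound c.
exists (K * B + dstar p c i * (K * C)).
  by rewrite ltr_wpDr ?mulr_gt0 // mulr_ge0 ?dstar_ge0 // mulr_ge0 // ltW.
move=> pi pi0 defect; have [q hq H] := HK pi pi0 defect.
have [j ji E] := reward_attained i hq; exists j => //.
set A := \sum_yt \sum_u pi yt u in H.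
have A0 : 0 <= A by apply: sumr_ge0 => yt _; apply: sumr_ge0.
have := H _ _ (ltW B0) (fun yt u => HB i j u yt); rewrite -info_rateE E.
have := H (fun=> c) _ (ltW C0) (fun yt u => HC u); rewrite -cost_rateE.
set X := \sum_yt _; set Z := \sum_yt _.
rewrite ler_norml => /andP[h1 _]; rewrite ler_norml => /andP[_ h2].
have d0 := dstar_ge0 i; have rd := reward_le_dstar i hq.
have AC0 : 0 <= A * cost_rate p c i q by rewrite mulr_ge0 // ltW // cost_rate_gt0.
have := ler_wpM2r AC0 rd.
have : dstar p c i * (A * cost_rate p c i q) <= dstar p c i * (X + K * C).
  by apply: ler_wpM2l => //; lra.
rewrite -/Z; lra.
Qed.

End Rates.

(** * Occupation measures and the information gathered by a truncated test *)

Section TreeConverse.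
Context {R : realType} {M : nat} {Y U : finType} (y0 : Y) (u0 : U)
  (p : 'I_M -> U -> Y -> Y -> R) (c : U -> R).
Context (hM : (1 < M)%N) (hp : forall i u yt, is_pmf (p i u yt))
  (hpos : forall i u yt y, 0 < p i u yt y) (hc : forall u, 0 < c u).
Local Notation Ex := (@Ex R M Y U y0 p).
Local Notation llr := (@llr R M Y U y0 p).
Implicit Types (phi : @policy R Y U) (h : @history Y U) (st : pred (@history Y U)).

Lemma st_stopped st h : st (stopped st h) = ~~ alive st h.
Proof.
have [ah|/stopped_stop[k [_ -> -> _]]//] := boolP (alive st h).
rewrite stopped_alive //; have := aliveP st h ah _ (leqnn _).
by rewrite take_size => /negPf.
Qed.

Section Occupation.
Context (phi : @policy R Y U) (hphi : is_policy phi) (st : pred (@history Y U))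
  (i : 'I_M) (n : nat).

(** The expected number of times before [n] at which the running test is in the
    state [yt] and applies the control [u]. *)
Definition occupation (yt : Y) (u : U) : R := \sum_(k < n)
  Ex phi i k (fun h => (alive st h)%:R * ((last_obs y0 h == yt)%:R * phi h u)).

Lemma occupation_ge0 yt u : 0 <= occupation yt u.
Proof.
apply: sumr_ge0 => k _; apply: Ex_ge0 => // h _.
by rewrite !mulr_ge0 ?ler0n // (hphi h).1.
Qed.

Lemma occupation_sum (r : Y -> U -> R) :
  \sum_yt \sum_u occupation yt u * r yt u =
  \sum_(k < n) Ex phi i k (fun h =>
     (alive st h)%:R * \sum_u phi h u * r (last_obs y0 h) u).
Proof.
under eq_bigr do under eq_bigr do rewrite mulr_suml.
under eq_bigr do rewrite exchange_big.
rewrite exchange_big; apply: eq_bigr => k _ /=.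
transitivity (Ex phi i k (fun h => \sum_yt \sum_u
    r yt u * ((alive st h)%:R * ((last_obs y0 h == yt)%:R * phi h u)))).
  rewrite Ex_sum; apply: eq_bigr => yt _; rewrite Ex_sum; apply: eq_bigr => u _.
  by rewrite ExZ mulrC.
apply: eq_Ex => h _; rewrite (bigD1 (last_obs y0 h)) //= addrC big1 ?add0r.
  by rewrite [RHS]mulr_sumr; apply: eq_bigr => u _; rewrite eqxx mul1r mulrC mulrA.
by move=> yt /negPf nyt; rewrite big1 // => u _; rewrite eq_sym nyt /= mul0r !mulr0.
Qed.

(** The flow into a state and the flow out of it differ only at the initial
    state and where the truncated test stops, i.e., by two unit masses. *)
Lemma occupation_defect :
  \sum_y `|(\sum_yt \sum_u occupation yt u * p i u yt y) - \sum_u occupation y u| <= 2.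
Proof.
pose E y := Ex phi i n (fun h => (last_obs y0 (stopped st h) == y)%:R).
have flow y : (\sum_yt \sum_u occupation yt u * p i u yt y) - \sum_u occupation y u =
    E y - (y0 == y)%:R.
  rewrite /E (Ex_stopped hp st i n (fun h => (last_obs y0 h == y)%:R)) //=.
  rewrite addrAC subrr add0r (occupation_sum (fun yt u => p i u yt y)).
  have -> : \sum_u occupation y u = \sum_(k < n) Ex phi i k (fun h =>
      (alive st h)%:R * (last_obs y0 h == y)%:R).
    rewrite exchange_big; apply: eq_bigr => k _; rewrite -Ex_sum.
    apply: eq_Ex => h _; rewrite -mulr_sumr -mulr_sumr (hphi h).2; ring.
  rewrite -sumrB; apply: eq_bigr => k _; rewrite -ExB; apply: eq_Ex => h _.
  rewrite -mulrBr /drift; congr (_ * (_ - _)); apply: eq_bigr => u _.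
  congr (_ * _); rewrite (bigD1 y) //= last_obs_rcons eqxx mulr1 big1 ?addr0 // => z.
  by move=> /negPf nz; rewrite last_obs_rcons /= nz mulr0.
under eq_bigr do rewrite flow.
have E1 : \sum_y E y = 1.
  rewrite -Ex_sum -[RHS](Ex_cst (y0 := y0) hp i n 1 hphi); apply: eq_Ex => h _.
  rewrite (bigD1 (last_obs y0 (stopped st h))) //= eqxx big1 ?addr0 // => z.
  by rewrite eq_sym => /negPf ->.
have D1 : \sum_y (y0 == y)%:R = 1 :> R.
  by rewrite (bigD1 y0) //= eqxx big1 ?addr0 // => z; rewrite eq_sym => /negPf ->.
rewrite (_ : 2 = \sum_y (E y + (y0 == y)%:R)); last by rewrite big_split /= E1 D1.
apply: ler_sum => y _; apply: le_trans (ler_normB _ _) _.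
rewrite !ger0_norm ?lexx ?ler0n //; apply: Ex_ge0 => // h _; exact: ler0n.
Qed.

End Occupation.

(** Truncating at a fixed time [n] makes all expectations finite sums. With [w]
    equal to [1/r] where [i] is decided and to 1 elsewhere,
    [S >= ln w + 1 - w exp (- S)] for the log-likelihood ratio [S] of [i] to [j].
    The mean of [S] under [i] is the accumulated divergence, and the mean of the
    last term is that of [w] under [j], which is at most 2. *)
Lemma tree_converse i : exists2 K, 0 < K &
  forall phi st (rule : @history Y U -> 'I_M) n (J r : R), is_policy phi -> 0 < r ->
  (forall j, j != i ->
     Ex phi j n (fun h => (~~ alive st h && (rule (stopped st h) == i))%:R) <= r) ->
  \sum_(k < n) Ex phi i k (fun h => (alive st h)%:R * \sum_u phi h u * c u) <= J ->
  Ex phi i n (fun h => (~~ alive st h && (rule (stopped st h) == i))%:R) * - ln r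
    <= dstar p c i * J + K.
Proof.
have [K K0 HK] := dstar_occupation y0 u0 hM hp hpos hc i.
exists (K + 1); first by rewrite addr_gt0.
move=> phi st rule n J r hphi r0 risk cost.
have [j ji info] := HK _ (occupation_ge0 hphi st i n) (occupation_defect hphi st i n).
rewrite (occupation_sum phi st i n (fun=> c)) in info.
rewrite (occupation_sum phi st i n (fun yt u => KL (p i u yt) (p j u yt))) in info.
pose A h : R := (st h && (rule h == i))%:R.
have EA k : Ex phi k n (fun h => (~~ alive st h && (rule (stopped st h) == i))%:R) =
    Ex phi k n (fun h => A (stopped st h)).
  by apply: eq_Ex => h _; rewrite /A st_stopped.
rewrite EA; have := risk j ji; rewrite EA => riskA.
pose w h := if st h && (rule h == i) then r^-1 else 1 : R.
have lb h : A h * - ln r + 1 - expR (- llr i j h) * w h <= llr i j h.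
  rewrite /A /w; case: (st h && _) => /=.
    have := expR_ge1Dx (- (llr i j h + ln r)); rewrite opprD expRD.
    rewrite [expR (- ln r)]expRN lnK ?posrE //; lra.
  by have := expR_ge1Dx (- llr i j h); lra.
have S : Ex phi i n (fun h => llr i j (stopped st h)) = \sum_(k < n) Ex phi i k
    (fun h => (alive st h)%:R * \sum_u phi h u *
       KL (p i u (last_obs y0 h)) (p j u (last_obs y0 h))).
  rewrite (Ex_stopped hp st) // {1}/llr cum_nil add0r; apply: eq_bigr => k _.
  by apply: eq_Ex => h _; rewrite drift_llr.
have change : Ex phi i n (fun h => expR (- llr i j (stopped st h)) * w (stopped st h)) <= 2.
  rewrite -Ex_stopped_llr //.
  have -> : 2 = 1 + r * r^-1 by rewrite divff ?gt_eqF.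
  apply: (@le_trans _ _ (Ex phi j n (fun h => 1 + r^-1 * A (stopped st h)))).
    apply: le_Ex => // h _ _; rewrite /w /A; have ri : 0 <= r^-1 by rewrite invr_ge0 ltW.
    by case: (_ && _); rewrite /=; lra.
  rewrite ExD ExZ (Ex_cst hp) // lerD2l mulrC.
  by rewrite ler_wpM2r ?invr_ge0 // ltW.
have : Ex phi i n (fun h => A (stopped st h) * - ln r + 1 -
    expR (- llr i j (stopped st h)) * w (stopped st h)) <=
    Ex phi i n (fun h => llr i j (stopped st h)) by apply: le_Ex => // h _ _; apply: lb.
rewrite S ExB ExD (Ex_cst hp) //.
have -> : Ex phi i n (fun h => A (stopped st h) * - ln r) =
    Ex phi i n (fun h => A (stopped st h)) * - ln r.
  by rewrite mulrC -ExZ; apply: eq_Ex => h _; rewrite mulrC.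
have := ler_wpM2l (dstar_ge0 y0 u0 hM hp hpos hc i) cost.
lra.
Qed.

End TreeConverse.

(** * From probability spaces to finite sums *)

Section Realization.
Context {R : realType} {M : nat} {Y U : finType} (y0 : Y)
  (p : 'I_M -> U -> Y -> Y -> R).
Context (hp : forall i u yt, is_pmf (p i u yt))
  (hpos : forall i u yt y, 0 < p i u yt y).
Context (phi : @policy R Y U) (X : experiment R M Y U) (hphi : is_policy phi)
  (hX : realizes y0 p phi X).
Local Notation Ex := (@Ex R M Y U y0 p).
Implicit Types (h : @history Y U) (Q : pred (@history Y U)) (i : 'I_M).

Lemma size_hist n (w : Omega X) : size (hist n w) = n.
Proof. by rewrite size_map size_iota. Qed.

Lemma hist_rcons n (w : Omega X) :
  hist n.+1 w = rcons (hist n w) (obs n.+1 w, ctl n.+1 w).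
Proof. by rewrite /hist -{1}(addn1 n) iotaD map_cat cats1 add1n. Qed.

Lemma take_hist k n (w : Omega X) : (k <= n)%N -> take k (hist n w) = hist k w.
Proof. by move=> kn; rewrite /hist -map_take take_iota (minn_idPl kn). Qed.

Lemma measurable_hist_eq n h : measurable [set w : Omega X | hist n w = h].
Proof.
have [mobs mctl _] := hX.
elim: n h => [|n IH] h.
  have [->|h0] := eqVneq h [::].
    by rewrite (_ : [set w | _] = setT)//; apply/seteqP; split.
  rewrite (_ : [set w | _] = set0) //; apply/seteqP; split => // w /= E.
  by rewrite -E eqxx in h0.
case/lastP: h => [|h [y u]].
  by rewrite (_ : [set w | _] = set0) //; apply/seteqP; split.
rewrite (_ : [set w | _] = [set w | hist n w = h] `&`
    ([set w | obs n.+1 w = y] `&` [set w | ctl n.+1 w = u])).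
  by apply: measurableI => //; apply: measurableI.
apply/seteqP; split => w /=; rewrite hist_rcons.
  by move=> /rcons_inj[-> -> ->].
by move=> [-> [-> ->]].
Qed.

(** The history takes finitely many values, so every event that depends on
    it only is a finite union of measurable ones. *)
Lemma measurable_hist n (Q : set (@history Y U)) :
  measurable [set w : Omega X | Q (hist n w)].
Proof.
rewrite (_ : [set w | _] = \bigcup_(t in [set t : n.-tuple (Y * U) | Q t])
    [set w | hist n w = t]).
  by apply: fin_bigcup_measurable => [|t _]; [exact: finite_finset | exact: measurable_hist_eq].
apply/seteqP; split => w /= => [Qw|[t Qt ->]//].
have sz : size (hist n w) == n by rewrite size_hist.
by exists (Tuple sz).
Qed.

Lemma measurable_fun_hist n (f : @history Y U -> \bar R) :
  measurable_fun setT (fun w : Omega X => f (hist n w)).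
Proof.
move=> _ B mB; rewrite setTI.
exact: (measurable_hist n [set h | B (f h)]).
Qed.

Lemma integral_hist i n (f : @history Y U -> R) : (forall h, 0 <= f h) ->
  (\int[Pr X i]_w (f (hist n w))%:E = (Ex phi i n f)%:E)%E.
Proof.
move=> f0.
have E w : (f (hist n w))%:E = (\sum_(t : n.-tuple (Y * U))
    (f t)%:E * (\1_[set w : Omega X | hist n w = t] w)%:E)%E.
  have sz : size (hist n w) == n by rewrite size_hist.
  rewrite (bigD1 (Tuple sz)) //= indicE mem_set // mule1 big1 ?adde0 // => t nt.
  rewrite indicE memNset ?mule0 //= => hw; move/eqP: nt; apply.
  by apply: val_inj; rewrite /= hw.
under eq_integral do rewrite E.
rewrite ge0_integral_sum //; last 2 first.
- move=> t; apply: (measurable_fun_hist n (fun h => (f t)%:E *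
    (\1_[set h : @history Y U | h = t] h)%:E)%E).
- by move=> t w _; rewrite mule_ge0 // lee_fin.
rewrite -sumEFin; apply: eq_bigr => t _.
rewrite ge0_integralZl_EFin //; last first.
  exact: (measurable_fun_hist n (fun h => (\1_[set h : @history Y U | h = t] h)%:E)).
rewrite integral_indic //; last exact: measurable_hist_eq.
have [_ _ PrX] := hX; have := PrX i t; rewrite size_tuple => PrXt; rewrite setIT mulrC EFinM.
by congr (_ * _)%E; rewrite -PrXt.
Qed.

Lemma Pr_hist i n Q :
  Pr X i [set w | Q (hist n w)] = (Ex phi i n (fun h => (Q h)%:R))%:E.
Proof.
rewrite -integral_hist //.
rewrite -[X in Pr _ _ X]setIT -(integral_indic (Pr X i)) //; last exact: (measurable_hist n (fun h => Q h)).
apply: eq_integral => w _; rewrite indicE; congr (_%:R%:E).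
congr nat_of_bool; have [Qw|nQw] := boolP (Q (hist n w)); first exact: mem_set.
by apply: memNset; apply/negP.
Qed.

End Realization.

Lemma le_of_harmonic {R : realType} (x y z : R) :
  (forall n : nat, x <= z + y / n.+1%:R) -> x <= z.
Proof.
move=> H; apply/ler_addgt0Pr => e e0.
have [n Hn] : exists n : nat, `|y| / e < n%:R.
  by exists (Num.bound (`|y| / e)); apply: archi_boundP; rewrite divr_ge0 // ltW.
apply: le_trans (H n) _; rewrite lerD2l ler_pdivrMr // mulrC.
apply: le_trans (ler_norm y) _; rewrite -ler_pdivrMr //.
by apply: le_trans (ltW Hn) _; rewrite ler_nat.
Qed.

Section SequentialTest.
Context {R : realType} {M : nat} {Y U : finType} (y0 : Y)
  (p : 'I_M -> U -> Y -> Y -> R) (c : U -> R).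
Context (hp : forall i u yt, is_pmf (p i u yt))
  (hpos : forall i u yt y, 0 < p i u yt y) (hc : forall u, 0 < c u).
Local Notation Ex := (@Ex R M Y U y0 p).
Implicit Types (h : @history Y U) (i j : 'I_M) (D : pred 'I_M).

(** Abstract tests and the threshold test are both handled as first hitting times
    of a set of histories. *)
Definition stops_at (t : seqtest R M Y U) (st : pred (@history Y U)) : Prop :=
  forall (w : Omega (expt t)) n, stop w = Some n <->
    st (hist n w) /\ forall m, (m < n)%N -> ~~ st (hist m w).

(** Stopping at time [n] is an event of the filtration at [n], so two outcomes with
    the same history stop together. *)
Lemma seqtest_stops_at t : is_seqtest y0 p t -> exists st, stops_at t st.
Proof.
move=> [_ _ Ft].
pose st h := `[< exists w : Omega (expt t), stop w = Some (size h) /\ hist (size h) w = h >].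
have E n (w : Omega (expt t)) : st (hist n w) <-> stop w = Some n.
  split=> [/asboolP[w' [sw' hw']]|sw]; last first.
    by apply/asboolP; exists w; rewrite size_hist.
  rewrite size_hist in sw' hw'; have [A _ EA] := Ft n.
  have : [set w | stop w = Some n] w' by [].
  rewrite -EA => -[_]; rewrite /preimage /= hw' => Aw.
  suff : [set w | stop w = Some n] w by [].
  by rewrite -EA.
exists st => w n; split=> [sw|[/E//]]; split; first exact/E.
move=> m mn; apply/negP => /E; rewrite sw => -[nm].
by rewrite nm ltnn in mn.
Qed.

Section Stopped.
Context (t : seqtest R M Y U) (st : pred (@history Y U)) (hst : stops_at t st)
  (hphi : is_policy (pol t)) (hX : realizes y0 p (pol t) (expt t)).
Local Notation phi := (pol t).
Local Notation X := (expt t).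
Local Notation Pr := (Pr X).

Lemma alive_hist n (w : Omega X) :
  alive st (hist n w) = not_after n.+1 (stop w).
Proof.
have E : alive st (hist n w) <-> forall m, (m <= n)%N -> ~~ st (hist m w).
  split=> [/aliveP A m mn|A].
    by rewrite -(take_hist w mn); apply: A; rewrite size_hist.
  by apply/aliveP => m; rewrite size_hist => mn; rewrite take_hist //; apply: A.
have [ah|nah] := boolP (alive st (hist n w)).
  move/E: ah => A; case E1: (stop w) => [m|] //=.
  have [sm _] := (hst w m).1 E1; apply/esym; rewrite ltnNge; apply/negP => /A.
  by rewrite sm.
case E1: (stop w) => [m|] /=; last first.
  case/negP: nah; apply/E; elim/ltn_ind => m IH mn; apply/negP => sm.
  have : stop w = Some m; last by rewrite E1.
  by apply/hst; split => // k km; apply: IH => //; rewrite (leq_trans (ltnW km)).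
apply/esym/negbTE/negP => nm; case/negP: nah; apply/E => k kn.
have [_] := (hst w m).1 E1; apply.
exact: leq_ltn_trans kn nm.
Qed.

Lemma stopped_hist n (w : Omega X) : ~~ alive st (hist n w) ->
  exists m, [/\ (m <= n)%N, stop w = Some m & stopped st (hist n w) = hist m w].
Proof.
move=> nah; have [m [mn -> sm ms]] := stopped_stop nah.
rewrite size_hist in mn; exists m; split; rewrite ?take_hist //.
apply/hst; rewrite take_hist // in sm; split => // k km.
have := ms _ km; rewrite take_hist //; exact: leq_trans (ltnW km) mn.
Qed.

Definition decided D h : bool := ~~ alive st h && D (rule t (stopped st h)).

Definition decides D : set (Omega X) :=
  [set w | exists2 j, decision w = Some j & D j].

Lemma decided_hist D n (w : Omega X) : decided D (hist n w) <->
  exists m, [/\ (m <= n)%N, stop w = Some m & D (rule t (hist m w))].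
Proof.
rewrite /decided; split=> [/andP[nah]|[m [mn sm Dm]]].
  by have [m [mn sm ->]] := stopped_hist nah; exists m.
have nah : ~~ alive st (hist n w) by rewrite alive_hist sm /= -leqNgt.
rewrite nah; have [m' [_]] := stopped_hist nah.
by rewrite sm => -[<-] ->.
Qed.

Lemma decidesE D : decides D = \bigcup_n [set w | decided D (hist n w)].
Proof.
apply/seteqP; split => w.
  case=> j; rewrite /decision; case E: (stop w) => [m|] //= -[<-] Dj.
  by exists m => //=; apply/decided_hist; exists m.
by case=> n _ /decided_hist[m [_ sm Dm]]; exists (rule t (hist m w)) => //; rewrite /decision sm.
Qed.

Lemma measurable_decides D : measurable (decides D).
Proof.
rewrite decidesE; apply: bigcup_measurable => n _.
exact: (measurable_hist hX n (fun h => decided D h)).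
Qed.

Lemma Pr_decides_ge i D n :
  ((Ex phi i n (fun h => (decided D h)%:R))%:E <= Pr i (decides D))%E.
Proof.
rewrite -(Pr_hist hX); apply: le_measure; rewrite ?inE.
- exact: (measurable_hist hX n (fun h => decided D h)).
- exact: measurable_decides.
- by rewrite decidesE => w dw; exists n.
Qed.

Lemma Pr_decides_le i D (B : R) :
  (forall n, Ex phi i n (fun h => (decided D h)%:R) <= B) ->
  (Pr i (decides D) <= B%:E)%E.
Proof.
move=> H; pose F n := [set w | decided D (@hist R M Y U X n w)].
have mF n : measurable (F n) by exact: (measurable_hist hX n (fun h => decided D h)).
have ndF : {homo F : n m / (n <= m)%N >-> (n <= m)%O}.
  move=> n m nm; apply/subsetPset => w /decided_hist[k [kn sk Dk]].
  by apply/decided_hist; exists k; rewrite (leq_trans kn).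
have mDF : measurable (\bigcup_n F n) by rewrite -decidesE; exact: measurable_decides.
have cv := nondecreasing_cvg_mu (mu := Pr i) mF mDF ndF.
rewrite decidesE -(cvg_lim _ cv) //; apply: lime_le.
  by apply/cvg_ex; eexists; exact: cv.
apply: nearW => n /=; rewrite (Pr_hist hX) lee_fin; exact: H.
Qed.

Lemma Pr_decision_some i j :
  Pr i [set w | decision w = Some j] = Pr i (decides (pred1 j)).
Proof.
congr (Pr i _); apply/seteqP; split => w /=; first by move=> E; exists j => /=.
by case=> k -> /eqP ->.
Qed.

(** Whether the control number [k + 1] is applied is known from the first [k]
    observations, so its mean cost is computed from a history of length [k]. *)
Definition step_cost i k : R :=
  Ex phi i k (fun h => (alive st h)%:R * \sum_u phi h u * c u).

Lemma step_cost_ge0 i k : 0 <= step_cost i k.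
Proof.
apply: Ex_ge0 => // h _; rewrite mulr_ge0 ?ler0n // sumr_ge0 // => u _.
by rewrite mulr_ge0 ?(hphi h).1 // ltW.
Qed.

Lemma expected_costE i :
  expected_cost c t i = (\sum_(0 <= k <oo) (step_cost i k)%:E)%E.
Proof.
pose f k h := if alive st (take k h) then (if onth h k is Some x then c x.2 else 0) else 0.
have f0 k h : 0 <= f k h.
  by rewrite /f; case: ifP => // _; case: onth => // x; apply: ltW.
have E w : (\sum_(1 <= k <oo | not_after k (stop w)) (c (@ctl R M Y U X k w))%:E =
    \sum_(0 <= k <oo) (f k (hist k.+1 w))%:E)%E.
  rewrite eseries_mkcond -(nneseries_addn 1 (f := fun k => if not_after k (stop w)
    then (c (ctl k w))%:E else 0%E)) //; last first.
    by move=> k; case: ifP => // _; rewrite lee_fin ltW.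
  apply: eq_eseriesr => k _; rewrite addn1 /f take_hist // alive_hist.
  have -> : onth (hist k.+1 w) k = Some (obs k.+1 w, ctl k.+1 w).
    by rewrite hist_rcons onthE map_rcons nth_rcons size_map size_hist ltnn eqxx.
  by case: ifP.
rewrite /expected_cost; under eq_integral do rewrite E.
rewrite integral_nneseries //; last 2 first.
- by move=> k; apply: (measurable_fun_hist hX k.+1 (fun h => (f k h)%:E)).
- by move=> k w _; rewrite lee_fin.
apply: eq_eseriesr => k _; rewrite (integral_hist hX) //; congr EFin.
rewrite ExS; apply: eq_Ex => h sh; rewrite /step_mean.
have fr x : f k (rcons h x) = (alive st h)%:R * c x.2.
  rewrite /f -cats1 take_size_cat // onthE map_cat nth_cat size_map sh ltnn subnn /=.
  by case: ifP => _; rewrite ?mul1r ?mul0r.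
rewrite mulr_sumr; apply: eq_bigr => u _; rewrite mulrCA; congr (_ * _).
under eq_bigr do rewrite fr /=.
by rewrite -mulr_suml (hp _ _ _).2 mul1r.
Qed.

Lemma expected_cost_ge i n :
  ((\sum_(k < n) step_cost i k)%:E <= expected_cost c t i)%E.
Proof.
rewrite expected_costE -sumEFin -(big_mkord xpredT (fun k => (step_cost i k)%:E)).
by apply: nneseries_lim_ge => k _ _; rewrite lee_fin step_cost_ge0.
Qed.

Lemma expected_cost_le i (J : R) :
  (forall n, \sum_(k < n) step_cost i k <= J) -> (expected_cost c t i <= J%:E)%E.
Proof.
move=> H; rewrite expected_costE; apply: lime_le.
  by apply: is_cvg_nneseries => k _ _; rewrite lee_fin step_cost_ge0.
apply: nearW => n; rewrite big_mkord sumEFin lee_fin; exact: H.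
Qed.

(** The survival probabilities are nonincreasing, and each time survived costs at
    least the smallest control cost. *)
Lemma survival_le i (J : R) : (expected_cost c t i <= J%:E)%E ->
  exists2 K, 0 <= K & forall n, Ex phi i n (fun h => (alive st h)%:R) <= K / n.+1%:R.
Proof.
move=> HJ; have [e e0 He] := fin_pos_lbound hc.
have J0 : 0 <= J.
  have := le_trans (expected_cost_ge i 0) HJ.
  by rewrite big_ord0 lee_fin.
exists (J / e) => [|n]; first by rewrite divr_ge0 // ltW.
rewrite ler_pdivlMr ?ltr0Sn // ler_pdivlMr //.
have nonincr m k : (k <= m)%N -> Ex phi i m (fun h => (alive st h)%:R) <=
    Ex phi i k (fun h => (alive st h)%:R).
  move=> km; rewrite -(Ex_take hp i (fun h => (alive st h)%:R) hphi km).
  apply: le_Ex => // h sh _; case: (boolP (alive st h)) => [ah|_]; last exact: ler0n.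
  suff -> : alive st (take k h) by exact: lexx.
  apply/aliveP => l; rewrite size_takel ?sh // => lk.
  by rewrite take_takel //; apply: (aliveP _ _ ah); rewrite sh (leq_trans lk).
have := le_trans (expected_cost_ge i n.+1) HJ; rewrite lee_fin; apply: le_trans.
rewrite -mulrA mulrC -mulrA mulr_natl -[X in _ *+ X]card_ord -sumr_const.
apply: ler_sum => k _.
apply: (@le_trans _ _ (e * Ex phi i k (fun h => (alive st h)%:R))).
  by rewrite ler_pM2l // nonincr // -ltnS.
rewrite -ExZ; apply: le_Ex => // h _ _; rewrite mulrC ler_wpM2l ?ler0n //.
rewrite -[e]mul1r -(hphi h).2 mulr_suml; apply: ler_sum => u _.
by rewrite ler_wpM2l // (hphi h).1.
Qed.

Lemma correct_decision_ge i (J alpha : R) : (expected_cost c t i <= J%:E)%E ->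
  (Pr i (decides (predC1 i)) <= alpha%:E)%E ->
  exists2 K, 0 <= K & forall n,
    1 - alpha - K / n.+1%:R <= Ex phi i n (fun h => (decided (pred1 i) h)%:R).
Proof.
move=> HJ err; have [K K0 HK] := survival_le HJ; exists K => // n.
have := le_trans (Pr_decides_ge i (predC1 i) n) err; rewrite lee_fin.
have : 1 = Ex phi i n (fun h => (alive st h)%:R) +
    Ex phi i n (fun h => (decided (predC1 i) h)%:R) +
    Ex phi i n (fun h => (decided (pred1 i) h)%:R).
  rewrite -!ExD -[LHS](Ex_cst (y0 := y0) hp i n 1 hphi); apply: eq_Ex => h _.
  rewrite /decided; case: (alive st h); rewrite /= ?addr0 //.
  by case: (_ == i); rewrite /= ?addr0 ?add0r.
have := HK n; set x := K / _; lra.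
Qed.

End Stopped.
End SequentialTest.

(** * The converse bound *)

Section Converse.
Context {R : realType} {M : nat} {Y U : finType} (y0 : Y) (u0 : U)
  (p : 'I_M -> U -> Y -> Y -> R) (c : U -> R).
Context (hM : (1 < M)%N) (hp : forall i u yt, is_pmf (p i u yt))
  (hpos : forall i u yt y, 0 < p i u yt y) (hc : forall u, 0 < c u).
Implicit Types (t : seqtest R M Y U) (i j : 'I_M).

Lemma Pr_error_le_Pmax t i : (Pr (expt t) i (decides (predC1 i)) <= Pmax t)%E.
Proof.
exact: (le_bigmax_cond _ (fun i => Pr (expt t) i
  [set w | exists2 j, decision w = Some j & j != i])).
Qed.

Lemma Pr_decision_le_risk t i j : j != i ->
  (Pr (expt t) j (decides (pred1 i)) <= risk t i)%E.
Proof.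
move=> ji; rewrite -Pr_decision_some.
exact: (le_bigmax_cond _ (fun j => Pr (expt t) j [set w | decision w = Some i])).
Qed.

Lemma Pmax_ge0 t : (0 <= Pmax t)%E.
Proof. exact: le_trans (measure_ge0 _ _) (Pr_error_le_Pmax t (Ordinal hM)). Qed.

Lemma risk_ge0 t i : (0 <= risk t i)%E.
Proof.
have [j ji] := exists_other hM i.
exact: le_trans (measure_ge0 _ _) (Pr_decision_le_risk t ji).
Qed.

Lemma Pmax_le1 t : is_seqtest y0 p t -> (Pmax t <= 1)%E.
Proof.
move=> ht; have [_ hX _] := ht; have [st hst] := seqtest_stops_at ht.
apply: bigmax_le => // i _; apply: probability_le1.
exact: (measurable_decides hst hX (predC1 i)).
Qed.

Lemma risk_le_Pmax t i : is_seqtest y0 p t -> (risk t i <= Pmax t)%E.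
Proof.
move=> ht; have [_ hX _] := ht; have [st hst] := seqtest_stops_at ht.
apply: bigmax_le => [|j ji]; first exact: Pmax_ge0.
rewrite Pr_decision_some; apply: le_trans (Pr_error_le_Pmax t j).
apply: le_measure; rewrite ?inE; try exact: (measurable_decides hst hX).
by move=> w [k dk /eqP ki]; exists k => //=; rewrite ki eq_sym.
Qed.

Lemma expected_cost_ge0 t i : (0 <= expected_cost c t i)%E.
Proof.
apply: integral_ge0 => w _; apply: nneseries_ge0 => k _ _.
by rewrite lee_fin ltW.
Qed.

(** Letting the truncation time go to infinity in [tree_converse]. *)
Lemma converse_bound i : exists2 K, 0 < K &
  forall t, is_seqtest y0 p t -> forall J alpha r : R, 0 < r -> r <= 1 ->
  (expected_cost c t i <= J%:E)%E ->
  (Pr (expt t) i (decides (predC1 i)) <= alpha%:E)%E -> (risk t i <= r%:E)%E ->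
  (1 - alpha) * - ln r <= dstar p c i * J + K.
Proof.
have [K K0 HK] := tree_converse y0 u0 hM hp hpos hc i.
exists K => // t ht J alpha r r0 r1 HJ err hr.
have [hphi hX _] := ht; have [st hst] := seqtest_stops_at ht.
have [K' K'0 HK'] := correct_decision_ge hp hpos hc hst hphi hX HJ err.
have L0 : 0 <= - ln r by rewrite oppr_ge0 ln_le0.
apply: (@le_of_harmonic _ _ (K' * - ln r)) => n.
have risk_n j : j != i -> Ex (y0 := y0) (p := p) (pol t) j n
    (fun h => (decided t st (pred1 i) h)%:R) <= r.
  move=> ji; rewrite -lee_fin; apply: le_trans hr.
  by apply: le_trans (Pr_decision_le_risk t ji); apply: Pr_decides_ge.
have cost_n := le_trans (expected_cost_ge hp hpos hc hst hphi hX i n) HJ.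
rewrite lee_fin in cost_n.
have := HK (pol t) st (rule t) n J r hphi r0 risk_n cost_n.
have := ler_wpM2r L0 (HK' n).
by rewrite [K' * _ / _]mulrAC; set x := K' / _; rewrite /decided /=; lra.
Qed.

(** A hypothesis with the same kernels as [i] has the same law, so both error
    probabilities cannot be small unless the test may run forever. *)
Lemma converse_same_kernels i j t (J alpha r : R) : j != i ->
  (forall u yt, p i u yt =1 p j u yt) -> is_seqtest y0 p t ->
  (expected_cost c t i <= J%:E)%E ->
  (Pr (expt t) i (decides (predC1 i)) <= alpha%:E)%E -> (risk t i <= r%:E)%E ->
  1 - alpha <= r.
Proof.
move=> ji same ht HJ err hr.
have [hphi hX _] := ht; have [st hst] := seqtest_stops_at ht.
have [K' K'0 HK'] := correct_decision_ge hp hpos hc hst hphi hX HJ err.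
apply: (@le_of_harmonic _ _ K') => n.
have : Ex (y0 := y0) (p := p) (pol t) j n
    (fun h => (decided t st (pred1 i) h)%:R) <= r.
  rewrite -lee_fin; apply: le_trans hr.
  by apply: le_trans (Pr_decision_le_risk t ji); apply: Pr_decides_ge.
have -> : Ex (y0 := y0) (p := p) (pol t) j n
    (fun h => (decided t st (pred1 i) h)%:R) =
  Ex (y0 := y0) (p := p) (pol t) i n (fun h => (decided t st (pred1 i) h)%:R).
  apply: eq_bigr => h _; congr (_ * _); congr (_ * _).
  by apply: eq_bigr => k _; rewrite same.
have := HK' n; set x := K' / _; lra.
Qed.

(** A finite cost would contradict [converse_bound] as [r] tends to 0, or the
    comparison with a hypothesis that has the same kernels. *)
Lemma expected_cost_infinite i t (alpha : R) : is_seqtest y0 p t ->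
  (Pr (expt t) i (decides (predC1 i)) <= alpha%:E)%E -> alpha < 1 / 2 ->
  risk t i = 0%E \/ dstar p c i = 0 /\ (risk t i <= alpha%:E)%E ->
  expected_cost c t i = +oo%E.
Proof.
move=> ht err a2 H; have c0 := expected_cost_ge0 t i.
case E : (expected_cost c t i) c0 => [J| |] // _; exfalso.
have HJ : (expected_cost c t i <= J%:E)%E by rewrite E.
have [ri|[d0 ri]] := H; last first.
  have [j ji same] := dstar_eq0 y0 u0 hM hp hpos hc d0.
  have := converse_same_kernels ji same ht HJ err ri; lra.
have [K K0 HK] := converse_bound i.
pose B := dstar p c i * J + K; pose b := 2 * `|B| + 1.
have b0 : 0 <= b by rewrite addr_ge0 // mulr_ge0.
have r0 : 0 < expR (- b) by exact: expR_gt0.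
have r1 : expR (- b) <= 1 by rewrite -expR0 ler_expR oppr_le0.
have := HK t ht J alpha _ r0 r1 HJ err; rewrite ri lee_fin ltW // => /(_ isT).
rewrite expRK opprK -/B => H1.
have : 1 / 2 * b <= (1 - alpha) * b by apply: ler_wpM2r => //; lra.
have := ler_norm B; rewrite /b in H1 *; lra.
Qed.

Lemma cost_lower_bound i : 0 < dstar p c i -> exists2 K, 0 < K &
  forall t, is_seqtest y0 p t -> forall alpha r : R, 0 < r -> r <= 1 ->
  (Pr (expt t) i (decides (predC1 i)) <= alpha%:E)%E -> (risk t i <= r%:E)%E ->
  ((((1 - alpha) * - ln r - K) / dstar p c i)%:E <= expected_cost c t i)%E.
Proof.
move=> d0; have [K K0 HK] := converse_bound i; exists K => // t ht alpha r r0 r1 err hr.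
have c0 := expected_cost_ge0 t i.
case E : (expected_cost c t i) c0 => [J| |] // _; last by rewrite leey.
rewrite lee_fin ler_pdivrMr // lerBlDr mulrC (mulrC J).
by rewrite mulrC; apply: (HK t ht J alpha r r0 r1 _ err hr); rewrite E.
Qed.

Lemma converse (t : nat -> seqtest R M Y U) :
  (forall n, is_seqtest y0 p (t n)) -> Pmax (t n) @[n --> \oo] --> 0%E ->
  forall i, exists2 e : nat -> R, e @ \oo --> (0 : R) &
    \forall n \near \oo,
      (expected_cost c (t n) i >=
         - lne (risk (t n) i) / (dstar p c i)%:E * (1 + e n)%:E)%E /\
      (- lne (risk (t n) i) / (dstar p c i)%:E * (1 + e n)%:E >=
         - lne (Pmax (t n)) / (dstar p c i)%:E * (1 + e n)%:E)%E.
Proof.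
move=> ht P0 i; have [K K0 HK] := converse_bound i.
pose P n := fine (Pmax (t n)).
have PE n : Pmax (t n) = (P n)%:E.
  rewrite fineK // ge0_fin_numE ?Pmax_ge0 //.
  exact: le_lt_trans (Pmax_le1 (ht n)) (ltry _).
have P_ge0 n : 0 <= P n by rewrite -lee_fin -PE Pmax_ge0.
have Pcv : P @ \oo --> (0 : R) by apply: fine_cvg.
(* [K / - ln (P n)] absorbs the additive constant of [converse_bound]; where the
   error probability vanishes the cost is infinite and the bound is trivial *)
pose e n := if P n == 0 then 0 else - (P n + K / - ln (P n)).
have ecv : e @ \oo --> (0 : R).
  apply/cvgr0Pnorm_lt => eps eps0.
  have d0 : 0 < Num.min (eps / 2) (expR (- (2 * K / eps))).
    by rewrite lt_min divr_gt0 // expR_gt0.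
  apply: filterS (cvgr0_norm_lt _ Pcv _ d0) => n.
  rewrite (ger0_norm (P_ge0 n)) lt_min => /andP[P1 P2].
  rewrite /e; case: eqVneq => [_|Pn0]; first by rewrite normr0.
  have Pn : 0 < P n by rewrite lt0r Pn0 P_ge0.
  have L : 2 * K / eps < - ln (P n).
    by rewrite ltrNr -[X in _ < X]expRK ltr_ln ?posrE ?expR_gt0.
  have L0 : 0 < - ln (P n) by apply: lt_trans L; rewrite divr_gt0 // mulr_gt0.
  have KL : K / - ln (P n) < eps / 2.
    rewrite ltr_pdivrMr //; rewrite ltr_pdivrMr // in L; lra.
  by rewrite normrN ger0_norm ?addr_ge0 // ?divr_ge0 ?(ltW K0) ?(ltW L0) //; lra.
exists e => //.
have lt12 : 0 < (1 / 2 : R) by lra.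
apply: filterS2 (cvgr0_norm_lt _ Pcv _ lt12) (cvgr0_norm_lt _ ecv _ lt12) => n; rewrite (ger0_norm (P_ge0 n)) => Ph.
rewrite ltr_norml => /andP[e1 e2].
have err := Pr_error_le_Pmax (t n) i; rewrite PE in err.
have rP := risk_le_Pmax i (ht n); rewrite PE in rP.
have d_ge0 := dstar_ge0 y0 u0 hM hp hpos hc i.
split; last first.
  apply: lee_wpmul2r; first by rewrite lee_fin; lra.
  apply: lee_wpmul2r; first by rewrite inve_ge0 lee_fin.
  rewrite leeN2 lee_lne ?in_itv /= ?leey ?andbT ?risk_ge0 ?Pmax_ge0 //.
  exact: risk_le_Pmax.
have [r0|r_neq0] := eqVneq (risk (t n) i) 0%E.
  by rewrite (expected_cost_infinite (ht n) err Ph) ?leey //; left.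
have [d0|d_neq0] := eqVneq (dstar p c i) 0.
  by rewrite (expected_cost_infinite (ht n) err Ph) ?leey //; right.
have d0 : 0 < dstar p c i by rewrite lt0r d_neq0.
have r_ge0 := risk_ge0 (t n) i.
case E : (risk (t n) i) r_ge0 r_neq0 rP => [r| |] //.
rewrite lee_fin eqe => r0 rn0; rewrite lee_fin => rP.
have {rn0}r0 : 0 < r by rewrite lt0r rn0.
have Pn : 0 < P n by apply: lt_le_trans rP.
have c0 := expected_cost_ge0 (t n) i.
case EJ : (expected_cost c (t n) i) c0 => [J| |] // _; last by rewrite leey.
have r1 : r <= 1 by lra.
have : (1 - P n) * - ln r <= dstar p c i * J + K.
  by apply: (HK (t n) (ht n)) => //; rewrite ?EJ ?E.
rewrite lne_EFin // inver (negPf d_neq0) -EFinN -!EFinM lee_fin => H.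
rewrite mulrAC ler_pdivrMr // (mulrC J) /e gt_eqF //.
have Lr : - ln (P n) <= - ln r by rewrite lerN2 ler_ln.
have LP : 0 < - ln (P n) by rewrite oppr_gt0 ln_lt0 // Pn; lra.
have : K <= - ln r * (K / - ln (P n)).
  by rewrite mulrCA ler_peMr ?(ltW K0) // ler_pdivlMr // mul1r.
lra.
Qed.

End Converse.

(** * Exploration times and estimation of the hypothesis *)

Section ExplorationTimes.
Context {R : realType} (a : R) (a1 : 1 < a).

Definition expl_time (l : nat) : nat := `|Num.ceil (a ^+ l)|%N.

Let a0 : 0 < a. Proof. exact: lt_trans a1. Qed.

Let aX_gt0 l : 0 < a ^+ l. Proof. exact: exprn_gt0. Qed.

Lemma expl_timeE l : (expl_time l)%:Z = Num.ceil (a ^+ l).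
Proof. by rewrite gez0_abs // ceil_ge0 (lt_trans _ (aX_gt0 l)) ?ltrN10. Qed.

Lemma expl_time_ge l : a ^+ l <= (expl_time l)%:R.
Proof. by rewrite -[(_)%:R]/((expl_time l)%:Z%:~R) expl_timeE ceil_ge. Qed.

Lemma expl_time_lt l : (expl_time l)%:R < a ^+ l + 1.
Proof.
rewrite -[(_)%:R]/((expl_time l)%:Z%:~R) expl_timeE -ltrBlDr.
by have := ceilB1_lt (a ^+ l); rewrite intrB.
Qed.

Lemma exploration_timeP k : exploration_time a k <-> exists l, k = expl_time l.
Proof.
split=> -[l E]; exists l; last by rewrite E expl_timeE.
by have := esym E; rewrite -expl_timeE => -[].
Qed.

Lemma expl_time_gap l : 3 <= a ^+ l * (a - 1) ->
  (expl_time l + 2 <= expl_time l.+1)%N.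
Proof.
move=> gap; rewrite -(ler_nat R) natrD.
have := expl_time_lt l; have := expl_time_ge l.+1; rewrite exprS; lra.
Qed.

Lemma expr_unbounded (x : R) : exists l : nat, x <= a ^+ l.
Proof.
exists (Num.bound (`|x| / (a - 1))).
set l := Num.bound _.
have lx : `|x| / (a - 1) < l%:R by apply: archi_boundP; rewrite divr_ge0 ?subr_ge0 // ltW.
have bern n : 1 + n%:R * (a - 1) <= a ^+ n.
  elim: n => [|n IH]; first by rewrite mul0r addr0 expr0.
  have n0 : 0 <= n%:R :> R by exact: ler0n.
  rewrite exprS -natr1; have := ler_wpM2l (ltW a0) IH.
  have : 0 <= n%:R * (a - 1) * (a - 1) by rewrite !mulr_ge0 // subr_ge0 ltW.
  lra.
apply: le_trans (bern l); apply: le_trans (ler_norm x) _.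
rewrite ltr_pdivrMr ?subr_gt0 // in lx; lra.
Qed.

(** Linear functions are eventually below exponentials: [exp x >= (x/2)^2] and
    [l <= delta l^2 + 1/(4 delta)]. *)
Lemma index_le_expr (eps : R) : 0 < eps ->
  exists2 K, 0 < K & forall l : nat, l%:R <= eps * a ^+ l + K.
Proof.
move=> eps0; pose lam := ln a / 2; have lam0 : 0 < lam by rewrite divr_gt0 ?ln_gt0.
pose del := eps * lam ^+ 2; have del0 : 0 < del by rewrite mulr_gt0 ?exprn_gt0.
exists (1 / (4 * del)); first by rewrite divr_gt0 // mulr_gt0.
move=> l.
have aE : a ^+ l = expR (l%:R * lam) ^+ 2.
  rewrite -expRM_natl -[in LHS](lnK (x := a)) ?posrE // -expRM_natl; congr expR.
  by rewrite /lam; field.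
have sq : (l%:R * lam) ^+ 2 <= a ^+ l.
  have ll : 0 <= l%:R * lam by rewrite mulr_ge0 ?ler0n // ltW.
  rewrite aE ler_pXn2r ?nnegrE ?expR_ge0 //.
  by have := expR_ge1Dx (l%:R * lam); lra.
have : del * l%:R ^+ 2 <= eps * a ^+ l.
  by rewrite /del -mulrA ler_pM2l // -exprMn mulrC.
suff : l%:R <= del * l%:R ^+ 2 + 1 / (4 * del) by lra.
have : 0 <= (2 * del * l%:R - 1) ^+ 2 / (4 * del).
  by rewrite divr_ge0 ?sqr_ge0 // mulr_ge0 // ltW.
have -> : (2 * del * l%:R - 1) ^+ 2 / (4 * del) =
    del * l%:R ^+ 2 + 1 / (4 * del) - l%:R by field; rewrite gt_eqF.
lra.
Qed.

Lemma exploration_count (eps : R) : 0 < eps -> exists2 K, 0 < K & forall n : nat,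
  \sum_(k < n) (`[< exploration_time a k.+1 >])%:R <= eps * n%:R + K.
Proof.
move=> eps0; have [K K0 HK] := index_le_expr eps0.
exists (K + 1) => [|n]; first by rewrite addr_gt0.
have x0 : 0 <= eps * n%:R + K by rewrite addr_ge0 ?mulr_ge0 ?ler0n // ltW.
pose L := (Num.truncn (eps * n%:R + K)).+1.
have Lx : L%:R <= eps * n%:R + K + 1.
  by rewrite /L -natr1 lerD2r; have /andP[] := truncn_itv x0.
apply: le_trans (_ : L%:R <= _); last by rewrite addrA.
rewrite -natr_sum ler_nat -(big_mkord xpredT (fun k => nat_of_bool `[< exploration_time a k.+1 >])).
pose s := [seq k <- index_iota 0 n | `[< exploration_time a k.+1 >]].
have -> : (\sum_(0 <= k < n) `[< exploration_time a k.+1 >])%N = size s.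
  by rewrite size_filter -sum1_count [RHS]big_mkcond; apply: eq_bigr => k _; case: `[< _ >].
rewrite -[L](size_iota 0) -(size_map (fun l => (expl_time l).-1) (iota 0 L)).
apply: uniq_leq_size; first by rewrite /s filter_uniq // iota_uniq.
move=> k; rewrite mem_filter mem_index_iota => /andP[/asboolP/exploration_timeP[l kl] kn].
apply/mapP; exists l; last by rewrite -kl.
rewrite mem_iota /= add0n -(ltr_nat R).
have : l%:R <= eps * n%:R + K.
  apply: le_trans (HK l) _; rewrite lerD2r ler_pM2l //.
  by apply: le_trans (expl_time_ge l) _; rewrite -kl ler_nat.
move=> H; apply: le_lt_trans H _; rewrite /L.
by have /andP[] := truncn_itv x0.
Qed.

(** [H] never increases, and once the exploration times are at least two steps
    apart each of them costs a factor [beta]; the times grow like [a ^+ l], so the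
    sum is dominated by a geometric series of ratio [beta * a < 1]. *)
Lemma exploration_decay_sum (beta : R) : 0 < beta -> a ^+ 2 * beta <= 1 ->
  exists2 K, 0 < K & forall H : nat -> R,
  H 0%N = 1 -> (forall n, 0 <= H n) -> (forall n, H n.+1 <= H n) ->
  (forall n, exploration_time a n.+2 -> H n.+2 <= beta * H n) ->
  forall n, \sum_(k < n) H k <= K.
Proof.
move=> b0 ab.
have [l0 Hl0] := expr_unbounded (3 / (a - 1)).
have gap l : (l0 <= l)%N -> 3 <= a ^+ l * (a - 1).
  move=> ll; rewrite -ler_pdivrMr ?subr_gt0 //; apply: le_trans Hl0 _.
  by rewrite ler_weXn2l // ltW.
have ba : beta * a < 1.
  rewrite -(ltr_pM2r a0) mul1r -mulrA -expr2 mulrC.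
  exact: le_lt_trans ab a1.
pose C := 2 * a ^+ l0.+1.
have C0 : 0 < C by rewrite mulr_gt0.
pose t m := expl_time (l0 + m).
exists ((t 0%N)%:R + C / (1 - beta * a)).
  by apply: ltr_wpDl; rewrite ?ler0n // divr_gt0 // subr_gt0.
move=> H H0 Hge0 Hdec Hexp n.
have Hmono k m : (k <= m)%N -> H m <= H k.
  move=> km; rewrite -(subnKC km); elim: (m - k)%N => [|r IH]; first by rewrite addn0.
  by rewrite addnS; apply: le_trans (Hdec _) IH.
have Hle1 k : H k <= 1 by rewrite -H0; apply: Hmono.
have tgap m : (t m + 2 <= t m.+1)%N by rewrite /t (addnS l0); apply/expl_time_gap/gap/leq_addr.
have Ht m : H (t m) <= beta ^+ m.
  elim: m => [|m IH]; first by rewrite expr0.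
  have := tgap m; rewrite addn2; case E : (t m.+1) => [|[|k]] //; rewrite !ltnS => tk.
  have /Hexp : exploration_time a k.+2 by apply/exploration_timeP; exists (l0 + m.+1)%N.
  move=> /le_trans; apply; rewrite exprS ler_pM2l //.
  exact: le_trans (Hmono _ _ tk) IH.
have blocks m : \sum_(k < t m) H k <= (t 0%N)%:R + C * \sum_(k < m) (beta * a) ^+ k.
  elim: m => [|m IH].
    rewrite big_ord0 mulr0 addr0 -[X in _ <= X%:R]card_ord -sum1_card natr_sum.
    by apply: ler_sum => k _; apply: Hle1.
  have tm : (t m <= t m.+1)%N by apply: leq_trans (tgap m); apply: leq_addr.
  rewrite -(big_mkord xpredT H) (big_cat_nat (leq0n _) tm) //= big_mkord.
  rewrite big_ord_recr mulrDr addrA /=; apply: lerD => //.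
  apply: (@le_trans _ _ (\sum_(t m <= k < t m.+1) beta ^+ m)).
    rewrite !big_nat; apply: ler_sum => k /andP[tk _].
    exact: le_trans (Hmono _ _ tk) (Ht m).
  rewrite sumr_const_nat -[X in X <= _]mulr_natl exprMn mulrCA mulrC ler_pM2l ?exprn_gt0 //.
  apply: (@le_trans _ _ ((t m.+1)%:R)); first by rewrite ler_nat leq_subr.
  rewrite /C -mulrA -exprD addSnnS; apply: le_trans (ltW (expl_time_lt _)) _.
  rewrite mulr_natl mulr2n addnS lerD2l; apply: exprn_ege1; exact: ltW.
have [m Hm] := expr_unbounded n%:R.
have nt : (n <= t m)%N.
  rewrite -(ler_nat R); apply: le_trans Hm _; apply: le_trans (expl_time_ge _).
  by rewrite ler_weXn2l ?leq_addl // ltW.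
apply: le_trans (_ : \sum_(k < t m) H k <= _).
  rewrite -!(big_mkord xpredT H) (big_cat_nat (leq0n _) nt) //= lerDl.
  by apply: sumr_ge0.
apply: le_trans (blocks m) _; rewrite lerD2l ler_pM2l //.
have ba0 : 0 <= beta * a by rewrite mulr_ge0 // ltW.
rewrite -[X in _ <= X]mul1r ler_pdivlMr ?subr_gt0 // mulrC.
have -> : (1 - beta * a) * \sum_(k < m) (beta * a) ^+ k = 1 - (beta * a) ^+ m.
  by rewrite -[1 - beta * a]opprB mulNr -subrX1 opprB.
by rewrite gerBl exprn_ge0.
Qed.

End ExplorationTimes.

Section Affinity.
Context {R : realType} {M : nat} {Y U : finType} (y0 : Y) (u0 : U)
  (p : 'I_M -> U -> Y -> Y -> R).
Context (hp : forall i u yt, is_pmf (p i u yt))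
  (hpos : forall i u yt y, 0 < p i u yt y).
Local Notation Ex := (@Ex R M Y U y0 p).
Local Notation llr := (@llr R M Y U y0 p).
Implicit Types (i j : 'I_M).

(** The one-step factor of the square root of the likelihood ratio of [j] to [i]. *)
Let z i j u yt y : R := expR (- (ln (p i u yt y / p j u yt y) / 2)).

Let z2 i j u yt y : z i j u yt y ^+ 2 = p j u yt y / p i u yt y.
Proof.
rewrite /z -expRM_natl mulrN mulrCA divff ?mulr1 ?pnatr_eq0 // expRN lnK.
  by rewrite invf_div.
by rewrite posrE divr_gt0.
Qed.

Let z_gt0 i j u yt y : 0 < z i j u yt y. Proof. exact: expR_gt0. Qed.

(** The Bhattacharyya coefficient of the two kernels, i.e., the sum over [y] of
    [sqrt (p_i p_j)]. *)
Definition affinity i j u yt : R := \sum_y p i u yt y * z i j u yt y.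

Let affinity_gap i j u yt :
  1 - affinity i j u yt = \sum_y p i u yt y * (1 - z i j u yt y) ^+ 2 / 2.
Proof.
rewrite -[in LHS](_ : \sum_y (p i u yt y + p j u yt y) / 2 = 1).
  rewrite -sumrB; apply: eq_bigr => y _.
  have -> : (1 - z i j u yt y) ^+ 2 = 1 - 2 * z i j u yt y + z i j u yt y ^+ 2.
    by ring.
  rewrite z2; have ? : p i u yt y != 0 by rewrite gt_eqF.
  by field.
by rewrite -mulr_suml big_split /= !(hp _ _ _).2; field.
Qed.

Lemma affinity_le1 i j u yt : affinity i j u yt <= 1.
Proof.
rewrite -subr_ge0 affinity_gap; apply: sumr_ge0 => y _.
by rewrite divr_ge0 // mulr_ge0 ?sqr_ge0 // ltW.
Qed.

Lemma affinity_lt1 i j u yt y : p i u yt y != p j u yt y -> affinity i j u yt < 1.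
Proof.
move=> ne; rewrite -subr_gt0 affinity_gap (bigD1 y) //=; apply: ltr_pwDl.
  rewrite divr_gt0 // mulr_gt0 // lt0r sqr_ge0 andbT sqrf_eq0 subr_eq0.
  apply: contraNneq ne => z1.
  have := z2 i j u yt y; rewrite -z1 expr1n => /(congr1 ( *%R^~ (p i u yt y))).
  by rewrite mul1r divfK ?(gt_eqF (hpos _ _ _ _)) // => /eqP.
by apply: sumr_ge0 => x _; rewrite divr_ge0 // mulr_ge0 ?sqr_ge0 // ltW.
Qed.

Lemma step_mean_affinity phi i j (r : Y -> R) h :
  step_mean (y0 := y0) (p := p) phi i (fun h => expR (- (llr i j h / 2)) * r (last_obs y0 h)) h =
  expR (- (llr i j h / 2)) * \sum_u phi h u * \sum_y
    p i u (last_obs y0 h) y * z i j u (last_obs y0 h) y * r y.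
Proof.
rewrite /step_mean mulr_sumr; apply: eq_bigr => u _; rewrite mulrCA; congr (_ * _).
rewrite mulr_sumr; apply: eq_bigr => y _.
rewrite /llr cum_rcons /= -/(llr i j) last_obs_rcons mulrDl opprD expRD /z /=.
ring.
Qed.

(** The mean under [i] of the square root of the likelihood ratio of [j] to [i]; by
    Markov's inequality it bounds the probability that [j] is preferred to [i]. *)
Definition root_ratio phi i j n : R := Ex phi i n (fun h => expR (- (llr i j h / 2))).

Lemma root_ratioS phi i j n : root_ratio phi i j n.+1 =
  Ex phi i n (fun h => expR (- (llr i j h / 2)) *
     \sum_u phi h u * affinity i j u (last_obs y0 h)).
Proof.
rewrite /root_ratio ExS; apply: eq_Ex => h _.
have := step_mean_affinity phi i j (fun=> 1) h.
under [X in step_mean _ _ X]funext do rewrite mulr1.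
move=> ->; congr (_ * _); apply: eq_bigr => u _; congr (_ * _).
by apply: eq_bigr => y _; rewrite mulr1.
Qed.

Lemma root_ratio0 phi i j : root_ratio phi i j 0 = 1.
Proof. by rewrite /root_ratio Ex0 /llr cum_nil mul0r oppr0 expR0. Qed.

Lemma root_ratio_ge0 phi i j n : is_policy phi -> 0 <= root_ratio phi i j n.
Proof. by move=> hphi; apply: Ex_ge0 => // h _; apply: expR_ge0. Qed.

Lemma root_ratio_decr phi i j n : is_policy phi ->
  root_ratio phi i j n.+1 <= root_ratio phi i j n.
Proof.
move=> hphi; rewrite root_ratioS; apply: le_Ex => // h _ _.
rewrite -[X in _ <= X]mulr1 ler_wpM2l ?expR_ge0 // -(hphi h).2.
by apply: ler_sum => u _; rewrite -[X in _ <= X]mulr1 ler_wpM2l ?(hphi h).1 ?affinity_le1.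
Qed.

(** Whatever the control, a state from which [i] and [j] can be told apart is
    reached in one step with probability bounded below; a uniform control there
    then reduces the expected root of the likelihood ratio by a fixed factor. *)
Lemma root_ratio_exploration i j : (exists u yt y, p i u yt y != p j u yt y) ->
  exists2 beta, 0 < beta < 1 & forall phi n, is_policy phi ->
  (forall h, size h = n.+1 -> phi h = fun=> #|U|%:R^-1) ->
  root_ratio phi i j n.+2 <= beta * root_ratio phi i j n.
Proof.
move=> [u1 [y1 [x1 ne]]].
have [zeta zeta0 Hzeta] := @fin_pos_lbound R _ (fun v : U * Y =>
  p i v.1 v.2 y1 * z i j v.1 v.2 y1) (fun v => mulr_gt0 (hpos _ _ _ _) (z_gt0 _ _ _ _ _)).
have U0 : 0 < #|U|%:R :> R by rewrite ltr0n; apply/card_gt0P; exists u0.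
pose rho yt := \sum_u #|U|%:R^-1 * affinity i j u yt.
pose del := 1 - rho y1.
have rho_le1 yt : rho yt <= 1.
  rewrite -(uniform_pmf u0).2; apply: ler_sum => u _.
  by rewrite -[X in _ <= X]mulr1 ler_pM2l ?invr_gt0 // affinity_le1.
have del0 : 0 < del.
  rewrite subr_gt0 -(uniform_pmf u0).2 /rho (bigD1 u1) //= [X in _ < X](bigD1 u1) //=.
  apply: ltr_leD.
    by rewrite -[X in _ < X]mulr1 ltr_pM2l ?invr_gt0 // (affinity_lt1 ne).
  apply: ler_sum => u _.
  by rewrite -[X in _ <= X]mulr1 ler_pM2l ?invr_gt0 // affinity_le1.
pose e := Num.min (zeta * del) (1 / 2).
have e0 : 0 < e by rewrite lt_min mulr_gt0 // divr_gt0.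
have e1 : e <= 1 / 2 by rewrite ge_min lexx orbT.
have ez : e <= zeta * del by rewrite ge_min lexx.
exists (1 - e); first by apply/andP; split; lra.
move=> phi n hphi unif.
have -> : root_ratio phi i j n.+2 = Ex phi i n.+1 (fun h =>
    expR (- (llr i j h / 2)) * rho (last_obs y0 h)).
  by rewrite root_ratioS; apply: eq_Ex => h sh; rewrite unif.
rewrite ExS -ExZ; apply: le_Ex => // h _ _.
rewrite step_mean_affinity mulrC ler_wpM2r ?expR_ge0 //.
rewrite -[1 - e]mul1r -[X in _ <= X * _](hphi h).2 mulr_suml; apply: ler_sum => u _.
rewrite ler_wpM2l ?(hphi h).1 //; set yt := last_obs y0 h.
apply: (@le_trans _ _ (affinity i j u yt - p i u yt y1 * z i j u yt y1 * del)).
  rewrite /affinity (bigD1 y1) //= [X in _ <= X - _](bigD1 y1) //= /del.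
  have : \sum_(y | y != y1) p i u yt y * z i j u yt y * rho y <=
      \sum_(y | y != y1) p i u yt y * z i j u yt y.
    apply: ler_sum => y _; rewrite -[X in _ <= X]mulr1.
    by rewrite ler_wpM2l ?mulr_ge0 ?(ltW (hpos _ _ _ _)) ?(ltW (z_gt0 _ _ _ _ _)).
  lra.
apply: lerD; first exact: affinity_le1.
rewrite lerN2.
apply: le_trans ez _; rewrite ler_pM2r //; exact: (Hzeta (u, yt)).
Qed.

End Affinity.

Section Estimation.
Context {R : realType} {M : nat} {Y U : finType} (y0 : Y) (u0 : U)
  (p : 'I_M -> U -> Y -> Y -> R).
Context (hp : forall i u yt, is_pmf (p i u yt))
  (hpos : forall i u yt y, 0 < p i u yt y).
Local Notation Ex := (@Ex R M Y U y0 p).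
Local Notation llr := (@llr R M Y U y0 p).
Implicit Types (i j : 'I_M).

Lemma uniform_exploration_factor : exists2 beta : R, 0 < beta < 1 &
  forall i j, (exists u yt y, p i u yt y != p j u yt y) ->
  forall phi n, is_policy phi ->
  (forall h, size h = n.+1 -> phi h = fun=> #|U|%:R^-1) ->
  root_ratio y0 p phi i j n.+2 <= beta * root_ratio y0 p phi i j n.
Proof.
have H (ij : 'I_M * 'I_M) : exists beta : R, 0 < beta < 1 /\
    ((exists u yt y, p ij.1 u yt y != p ij.2 u yt y) ->
    forall phi n, is_policy phi ->
    (forall h, size h = n.+1 -> phi h = fun=> #|U|%:R^-1) ->
    root_ratio y0 p phi ij.1 ij.2 n.+2 <= beta * root_ratio y0 p phi ij.1 ij.2 n).
  have [ne|eq] := pselect (exists u yt y, p ij.1 u yt y != p ij.2 u yt y).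
    by have [beta b01 Hb] := root_ratio_exploration y0 u0 hp hpos ne; exists beta.
  by exists (1 / 2); split => //; apply/andP; split; lra.
have [b Hb] := choice H.
have b_lt1 ij : 0 < 1 - b ij by rewrite subr_gt0; have [/andP[]] := Hb ij.
have [e e0 He] := fin_pos_lbound b_lt1.
pose e' := Num.min e (1 / 2).
have e'0 : 0 < e' by rewrite lt_min e0 divr_gt0.
have e'1 : e' <= 1 / 2 by rewrite ge_min lexx orbT.
have e'e : e' <= e by rewrite ge_min lexx.
exists (1 - e'); first by apply/andP; split; lra.
move=> i j ne phi n hphi unif; have [_ Hij] := Hb (i, j).
apply: le_trans (Hij ne phi n hphi unif) _.
rewrite ler_wpM2r ?root_ratio_ge0 //; have := He (i, j); lra.
Qed.

Lemma misestimation_le phi ihat i n : is_policy phi -> is_ML y0 p phi ihat ->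
  Ex phi i n (fun h => (ihat h != i)%:R) <= \sum_(j | j != i) root_ratio y0 p phi i j n.
Proof.
move=> hphi ML; rewrite -Ex_sum; apply: le_Ex => // h _ J.
case: (boolP (ihat h != i)) => ih /=; last first.
  by apply: sumr_ge0 => j _; apply: expR_ge0.
rewrite (bigD1 (ihat h)) //=; apply: ler_wpDr.
  by apply: sumr_ge0 => j _; apply: expR_ge0.
rewrite -[X in X <= _]expR0 ler_expR oppr_ge0 pmulr_lle0 ?invr_gt0 //.
have := ML h i; rewrite (joint_llr hpos phi i (ihat h)).
by rewrite -[X in X <= _]mulr1 ler_pM2l // -[X in X <= _]expR0 ler_expR oppr_ge0.
Qed.

(** The factor gained at an exploration time does not depend on the exploration
    base [a]; for [a] close to 1 these times are frequent enough for the expected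
    number of misestimations to be finite. *)
Lemma misestimation_sum : exists2 a0 : R, 1 < a0 &
  forall a, 1 < a -> a < a0 -> forall phi ihat i, is_policy phi ->
  is_ML y0 p phi ihat ->
  (forall h, exploration_time a (size h).+1 -> phi h = fun=> #|U|%:R^-1) ->
  (forall j, j != i -> exists u yt y, p i u yt y != p j u yt y) ->
  exists K, forall n, \sum_(k < n) Ex phi i k (fun h => (ihat h != i)%:R) <= K.
Proof.
have [beta /andP[b0 b1] Hb] := uniform_exploration_factor.
pose kap := 1 - beta; have k0 : 0 < kap by rewrite subr_gt0.
exists (1 + kap / 4); first by rewrite ltrDl divr_gt0.
move=> a a1 aa phi ihat i hphi ML unif dist.
have ab : a ^+ 2 * beta <= 1.
  have a2 : a ^+ 2 <= 1 + kap.
    apply: (@le_trans _ _ ((1 + kap / 4) ^+ 2)).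
      by rewrite ler_pXn2r ?nnegrE //; lra.
    have : kap * kap <= kap * 1 by rewrite ler_pM2l // /kap; lra.
    have -> : (1 + kap / 4) ^+ 2 = 1 + kap / 2 + kap * kap / 16 by field.
    lra.
  apply: (@le_trans _ _ ((1 + kap) * beta)); first by rewrite ler_pM2r.
  by rewrite /kap; have := sqr_ge0 (1 - beta); nra.
have [K K0 HK] := exploration_decay_sum a1 b0 ab.
exists (\sum_(j | j != i) K) => n.
apply: (@le_trans _ _ (\sum_(k < n) \sum_(j | j != i) root_ratio y0 p phi i j k)).
  by apply: ler_sum => k _; apply: misestimation_le.
rewrite exchange_big; apply: ler_sum => j ji; apply: HK.
- exact: root_ratio0.
- by move=> k; apply: root_ratio_ge0.
- by move=> k; apply: root_ratio_decr.
- move=> k ek; apply: (Hb i j (dist j ji)) => // h sh; apply: unif.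
  by rewrite sh.
Qed.

End Estimation.

(** * Accumulation of information *)

Section Drift.
Context {R : realType} {M : nat} {Y U : finType} (y0 : Y)
  (p : 'I_M -> U -> Y -> Y -> R).
Context (hp : forall i u yt, is_pmf (p i u yt))
  (hpos : forall i u yt y, 0 < p i u yt y).
Local Notation Ex := (@Ex R M Y U y0 p).
Implicit Types (h : @history Y U).

Lemma expR_le_quadratic (x : R) : `|x| <= 1 / 2 -> expR x <= 1 + x + 2 * x ^+ 2.
Proof.
rewrite ler_norml => /andP[x1 x2].
have e0 : 0 < expR (- x) by apply: expR_gt0.
rewrite -[X in expR X]opprK expRN -[X in X <= _]div1r ler_pdivrMr //.
have h1 := expR_ge1Dx (- x).
have q0 : 0 <= 1 + x + 2 * x ^+ 2 by have := sqr_ge0 x; lra.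
apply: le_trans (ler_wpM2l q0 h1).
have : 0 <= x ^+ 2 * (1 - 2 * x) by rewrite mulr_ge0 ?sqr_ge0 //; lra.
rewrite !expr2; lra.
Qed.

(** Exponential moments: with [lam] small, [exp (- lam * cum w)] decreases in
    mean by a fixed factor at each step, hence is summable, and it dominates
    the negative part of [cum w]. *)
Lemma positive_drift_deficit phi i (w : @history Y U -> Y * U -> R) (B m : R) :
  is_policy phi -> 0 < m -> (forall h x, `|w h x| <= B) ->
  (forall h, m <= \sum_u phi h u * \sum_y p i u (last_obs y0 h) y * w h (y, u)) ->
  exists K, forall n, \sum_(k < n) Ex phi i k (fun h => Num.max 0 (- cum w h)) <= K.
Proof.
move=> hphi m0 wB drift_w.
pose b := `|B| + 1; have b0 : 0 < b by rewrite ltr_wpDl.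
have wb h x : `|w h x| <= b.
  by apply: le_trans (wB h x) _; apply: le_trans (ler_norm _) _; rewrite lerDl.
(* the second order term of the exponential is then at most half of the drift *)
pose lam := Num.min (1 / (2 * b)) (m / (4 * b ^+ 2)).
have lam0 : 0 < lam by rewrite lt_min !divr_gt0 ?mulr_gt0 ?exprn_gt0.
have lamb : lam * b <= 1 / 2.
  have : lam <= 1 / (2 * b) by rewrite ge_min lexx.
  by rewrite ler_pdivlMr ?mulr_gt0 //; lra.
have lamb2 : 2 * (lam * b ^+ 2) <= m / 2.
  have : lam <= m / (4 * b ^+ 2) by rewrite ge_min lexx orbT.
  by rewrite ler_pdivlMr ?mulr_gt0 ?exprn_gt0 //; lra.
pose Phi h := expR (- (lam * cum w h)).
pose kap := lam * m / 2; have kap0 : 0 < kap by rewrite divr_gt0 // mulr_gt0.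
have point h x : expR (- (lam * w h x)) <= 1 + 2 * (lam * b) ^+ 2 - lam * w h x.
  have lw : `|lam * w h x| <= lam * b by rewrite normrM gtr0_norm // ler_pM2l.
  have := @expR_le_quadratic (- (lam * w h x)); rewrite normrN sqrrN.
  move=> /(_ (le_trans lw lamb)) /le_trans; apply.
  have : (lam * w h x) ^+ 2 <= (lam * b) ^+ 2.
    by rewrite -[X in X <= _]real_normK ?num_real // ler_pXn2r ?nnegrE // ltW // mulr_gt0.
  lra.
have affine (I : finType) (f : I -> R) (hf : is_pmf f) k (G : I -> R) :
    \sum_a f a * (k - lam * G a) = k - lam * \sum_a f a * G a.
  under eq_bigr do rewrite mulrBr.
  rewrite sumrB -mulr_suml hf.2 mul1r mulr_sumr; congr (_ - _).
  by apply: eq_bigr => x _; rewrite mulrCA.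
have contract h : step_mean (y0 := y0) (p := p) phi i Phi h <= (1 - kap) * Phi h.
  have -> : step_mean (y0 := y0) (p := p) phi i Phi h = Phi h *
      \sum_u phi h u * \sum_y p i u (last_obs y0 h) y * expR (- (lam * w h (y, u))).
    rewrite /step_mean mulr_sumr; apply: eq_bigr => u _; rewrite mulrCA; congr (_ * _).
    rewrite mulr_sumr; apply: eq_bigr => y _.
    by rewrite /Phi cum_rcons mulrDr opprD expRD; ring.
  rewrite mulrC ler_wpM2r ?expR_ge0 //.
  apply: (@le_trans _ _ (1 + 2 * (lam * b) ^+ 2 - lam *
      \sum_u phi h u * \sum_y p i u (last_obs y0 h) y * w h (y, u))).
    rewrite -(affine _ _ (hphi h)); apply: ler_sum => u _.
    rewrite ler_wpM2l ?(hphi h).1 // -(affine _ _ (hp i u (last_obs y0 h))).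
    by apply: ler_sum => y _; rewrite ler_pM2l.
  have := ler_wpM2l (ltW lam0) (drift_w h).
  have : lam * (2 * (lam * b ^+ 2)) <= lam * (m / 2) by rewrite ler_pM2l.
  have -> : (lam * b) ^+ 2 = lam * (lam * b ^+ 2) by ring.
  rewrite /kap; lra.
have telescope n : kap * \sum_(k < n) Ex phi i k Phi <= 1 - Ex phi i n Phi.
  elim: n => [|n IH].
    by rewrite big_ord0 mulr0 Ex0 /Phi cum_nil mulr0 oppr0 expR0 subrr.
  rewrite big_ord_recr mulrDr /=.
  have : Ex phi i n.+1 Phi <= (1 - kap) * Ex phi i n Phi.
    by rewrite ExS -ExZ; apply: le_Ex.
  lra.
exists (1 / kap / lam) => n.
rewrite ler_pdivlMr // ler_pdivlMr //.
apply: (@le_trans _ _ (kap * \sum_(k < n) Ex phi i k Phi)); last first.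
  apply: le_trans (telescope n) _; rewrite gerBl; apply: Ex_ge0 => // h _.
  exact: expR_ge0.
rewrite mulrC ler_pM2l // mulr_suml; apply: ler_sum => k _.
rewrite mulrC -ExZ; apply: le_Ex => // h _ _.
rewrite maxr_pMr ?(ltW lam0) // mulr0 ge_max expR_ge0 /= mulrN /Phi.
by apply: le_trans (expR_ge1Dx _); rewrite lerDr.
Qed.

Definition visits (b : pred (@history Y U)) h : R := cum (fun h _ => (b h)%:R) h.

Lemma Ex_visits phi i (b : pred (@history Y U)) n : is_policy phi ->
  Ex phi i n (visits b) = \sum_(k < n) Ex phi i k (fun h => (b h)%:R).
Proof.
move=> hphi; transitivity (Ex phi i n (fun h => \sum_(k < n) (b (take k h))%:R)).
  by apply: eq_Ex => h sh; rewrite /visits /cum sh.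
rewrite Ex_sum; apply: eq_bigr => k _.
by rewrite (Ex_take hp i (fun h => (b h)%:R) hphi (ltnW (ltn_ord k))).
Qed.

Lemma visits_ge0 b h : 0 <= visits b h.
Proof. by apply: sumr_ge0 => k _; apply: ler0n. Qed.

Lemma visits_take b h k : visits b (take k h) <= visits b h.
Proof.
have [hk|kh] := leqP (size h) k; first by rewrite take_oversize.
rewrite /visits /cum size_takel ?(ltnW kh) //.
rewrite -!(big_mkord xpredT (fun l => (b (take l _))%:R)) (big_cat_nat (leq0n _) (ltnW kh)) /=.
apply: ler_wpDr; first by apply: sumr_ge0 => l _; apply: ler0n.
rewrite !big_nat; apply: ler_sum => l /andP[_ lk].
by rewrite take_takel // ltnW.
Qed.

End Drift.

Section StarCost.
Context {R : realType} {M : nat} {Y U : finType} (y0 : Y) (u0 : U)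
  (p : 'I_M -> U -> Y -> Y -> R) (c : U -> R).
Context (hM : (1 < M)%N) (hp : forall i u yt, is_pmf (p i u yt))
  (hpos : forall i u yt y, 0 < p i u yt y) (hc : forall u, 0 < c u).
Local Notation Ex := (@Ex R M Y U y0 p).
Local Notation llr := (@llr R M Y U y0 p).
Implicit Types (h : @history Y U) (i j : 'I_M) (phi : @policy R Y U).

Definition total_cost h : R := cum (fun _ x => c x.2) h.

(** Up to the boundary terms of the Poisson equation, the log-likelihood ratio
    minus [dstar - eps] times the cost has a positive drift whenever the
    control follows the maximizing law; the other times are paid for by [b]. *)
Lemma rate_deficit phi i j q (bad : pred (@history Y U)) (eps : R) :
  is_policy phi -> is_maximizer p c i q -> j != i -> 0 < eps ->
  (forall h, ~~ bad h -> phi h = q (last_obs y0 h)) ->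
  exists b K (D : @history Y U -> R),
    [/\ 0 < b, 0 < K, forall h, 0 <= D h, forall n, \sum_(k < n) Ex phi i k D <= K &
      forall h, (dstar p c i - eps) * total_cost h <=
        llr i j h + D h + b * visits bad h + K].
Proof.
move=> hphi qmax ji eps0 good; have [hq _] := qmax; set d := dstar p c i.
pose f yt := \sum_u q yt u * (KL (p i u yt) (p j u yt) - d * c u).
have [[_ mu1] muK] := mu_stationary y0 hp hpos i hq.
have [eta eta0 Heta] := kernel_lbound hpos.
have [g Hg] := poisson_equation y0 eta0
  (fun yt y => mixed_trans_lbound i yt y hq Heta) (fun yt => mixed_trans_sum1 hp i yt hq)
  f mu1 muK.
have theta0 : 0 <= \sum_y mu p i q y * f y.
  have -> : \sum_y mu p i q y * f y = info_rate p i j q - d * cost_rate p c i q.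
    rewrite /info_rate /cost_rate mulr_sumr -sumrB; apply: eq_bigr => y _.
    rewrite /f !mulr_sumr -sumrB; apply: eq_bigr => u _; ring.
  rewrite subr_ge0 /d (dstar_maximizer y0 hM hp hpos hc qmax).
  exact: (reward_le y0 hp hpos hc hq ji).
have [G G0 HG] := fin_ubound g; have [C C0 HC] := fin_ubound c.
have [L L0 HL] := @fin_ubound R _ (fun v : U * Y * Y =>
  ln (p i v.1.1 v.1.2 v.2 / p j v.1.1 v.1.2 v.2)).
have [e e0 He] := fin_pos_lbound hc.
pose B := L + `|d - eps| * C + 2 * G.
have B0 : 0 < B by rewrite addr_gt0 ?mulr_gt0 // ltr_wpDr // mulr_ge0 // ltW.
pose v h (x : Y * U) := ln (p i x.2 (last_obs y0 h) x.1 / p j x.2 (last_obs y0 h) x.1)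
  - (d - eps) * c x.2 + (g x.1 - g (last_obs y0 h)).
have vB h x : `|v h x| <= B.
  rewrite /v /B; apply: le_trans (ler_normD _ _) _; apply: lerD.
    apply: le_trans (ler_normB _ _) _; apply: lerD.
      exact: (HL (x.2, last_obs y0 h, x.1)).
    by rewrite normrM ler_wpM2l.
  apply: le_trans (ler_normB _ _) _; rewrite mulr_natl mulr2n.
  exact: lerD.
pose b := B + 1; pose w h x := v h x + b * (bad h)%:R.
have wB h x : `|w h x| <= B + b.
  apply: le_trans (ler_normD _ _) _; apply: lerD; first exact: vB.
  have b0 : 0 <= b by rewrite /b; lra.
  by rewrite normrM (ger0_norm b0) ler_piMr // ger0_norm ?ler0n //; case: (bad h).
have mean_cst h (k : R) : \sum_u phi h u * \sum_y p i u (last_obs y0 h) y * k = k.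
  exact: (step_mean_cst (y0 := y0) hp i k h hphi).
pose m := Num.min 1 (eps * e).
have m0 : 0 < m by rewrite lt_min ltr01 mulr_gt0.
have m1 : m <= 1 by rewrite ge_min lexx.
have me : m <= eps * e by rewrite ge_min lexx orbT.
have drift_w h : m <= \sum_u phi h u * \sum_y p i u (last_obs y0 h) y * w h (y, u).
  have [badh|goodh] := boolP (bad h).
    rewrite -[X in X <= _](mean_cst h m); apply: ler_sum => u _.
    rewrite ler_wpM2l ?(hphi h).1 //; apply: ler_sum => y _; rewrite ler_pM2l //.
    rewrite /w badh mulr1 /b; have := vB h (y, u); rewrite ler_norml => /andP[]; lra.
  set yt := last_obs y0 h.
  have -> : \sum_u phi h u * \sum_y p i u yt y * w h (y, u) =
      f yt + (\sum_y mixed_trans p i q yt y * g y) - g yt + eps * \sum_u q yt u * c u.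
    rewrite (good h goodh) -/yt.
    have -> : \sum_y mixed_trans p i q yt y * g y = \sum_u q yt u * \sum_y p i u yt y * g y.
      under eq_bigr do rewrite mulr_suml.
      rewrite exchange_big; apply: eq_bigr => u _; rewrite mulr_sumr.
      by apply: eq_bigr => y _; rewrite mulrA.
    have -> : g yt = \sum_u q yt u * g yt by rewrite -mulr_suml (hq yt).2 mul1r.
    rewrite /f mulr_sumr -big_split -sumrB -big_split /=; apply: eq_bigr => u _.
    have -> : KL (p i u yt) (p j u yt) - d * c u =
        \sum_y p i u yt y * (ln (p i u yt y / p j u yt y) - d * c u).
      under [RHS]eq_bigr do rewrite mulrBr.
      by rewrite sumrB -mulr_suml (hp _ _ _).2 mul1r.
    have one (k : R) : k = \sum_y p i u yt y * k by rewrite -mulr_suml (hp _ _ _).2 mul1r.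
    rewrite [in RHS](one (g yt)) [X in _ + eps * (_ * X)](one (c u)).
    rewrite !mulr_sumr -big_split -sumrB -big_split /=; apply: eq_bigr => y _.
    by rewrite /w (negPf goodh) /v /= -/yt; ring.
  rewrite Hg; apply: le_trans me _; apply: ler_wpDl => //.
  rewrite ler_pM2l // -[e]mul1r -(hq yt).2 mulr_suml; apply: ler_sum => u _.
  by rewrite ler_wpM2l // (hq yt).1.
have [K HK] := positive_drift_deficit hp hpos hphi m0 wB drift_w.
exists b, (`|K| + 2 * G), (fun h => Num.max 0 (- cum w h)); split.
- by rewrite /b; lra.
- by rewrite ltr_wpDl // mulr_gt0.
- by move=> h; rewrite le_max lexx.
- by move=> n; apply: le_trans (HK n) _; have := ler_norm K; lra.
move=> h.
have cw : cum w h = llr i j h - (d - eps) * total_cost h + g (last_obs y0 h) - g y0 +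
    b * visits bad h.
  rewrite /llr /total_cost /visits; elim/last_ind: h => [|h x IH].
    by rewrite !cum_nil /=; ring.
  by rewrite !cum_rcons IH last_obs_rcons /w /v; ring.
have : - cum w h <= Num.max 0 (- cum w h) by rewrite le_max lexx orbT.
rewrite {1}cw; set D := Num.max _ _ => HD.
have := HG y0; have := HG (last_obs y0 h); rewrite !ler_norml => /andP[? ?] /andP[? ?].
have K0 := normr_ge0 K; lra.
Qed.

Context (a : R) (qs : 'I_M -> Y -> U -> R) (ihat : @history Y U -> 'I_M)
  (phi : @policy R Y U).
Context (a1 : 1 < a) (qmax : forall i, is_maximizer p c i (qs i))
  (hstar : is_star_policy y0 p a qs ihat phi).

Lemma star_exploration h : exploration_time a (size h).+1 -> phi h = fun=> #|U|%:R^-1.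
Proof. by move=> eh; apply: funext => u; have [_ /(_ h u)[+ _]] := hstar; apply. Qed.

Lemma star_exploitation h : ~ exploration_time a (size h).+1 ->
  phi h = qs (ihat h) (last_obs y0 h).
Proof. by move=> eh; apply: funext => u; have [_ /(_ h u)[_ +]] := hstar; apply. Qed.

Lemma star_is_policy : is_policy phi.
Proof.
move=> h; have [eh|neh] := pselect (exploration_time a (size h).+1).
  by rewrite star_exploration //; apply: uniform_pmf.
by rewrite star_exploitation //; have [+ _] := qmax (ihat h); apply.
Qed.

Let hphi := star_is_policy.

Lemma total_cost_ge h (e : R) : (forall u, e <= c u) -> e * (size h)%:R <= total_cost h.
Proof.
move=> He; rewrite /total_cost; elim/last_ind: h => [|h x IH]; first by rewrite mulr0 cum_nil.
by rewrite size_rcons cum_rcons -natr1 mulrDr mulr1 lerD.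
Qed.

(** The exploration times have density zero, so a slightly smaller rate absorbs
    them; only the misestimations remain. *)
Lemma star_rate_deficit i j (eps : R) : j != i -> 0 < eps ->
  exists b K (D : @history Y U -> R),
    [/\ 0 < b, 0 < K, forall h, 0 <= D h, forall n, \sum_(k < n) Ex phi i k D <= K &
      forall h, (dstar p c i - eps) * total_cost h <=
        llr i j h + D h + b * visits (fun h => ihat h != i) h + K].
Proof.
move=> ji eps0; have eps2 : 0 < eps / 2 by rewrite divr_gt0.
pose expl h := `[< exploration_time a (size h).+1 >].
have [|b [K [D [b0 K0 D0 DK H]]]] := @rate_deficit phi i j (qs i)
  (fun h => expl h || (ihat h != i)) (eps / 2) hphi (qmax i) ji eps2.
  move=> h; rewrite negb_or negbK => /andP[/asboolPn neh /eqP hi].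
  by rewrite star_exploitation // hi.
have [e e0 He] := fin_pos_lbound hc.
have del0 : 0 < eps / 2 * e / b by rewrite divr_gt0 // mulr_gt0.
have [L L0 HL] := exploration_count a1 del0.
exists b, (K + b * L), D; split => //.
- by rewrite addr_gt0 // mulr_gt0.
- by move=> n; apply: le_trans (DK n) _; rewrite lerDl mulr_ge0 // ltW.
move=> h; have := H h.
have split_count : visits (fun h => expl h || (ihat h != i)) h <=
    visits expl h + visits (fun h => ihat h != i) h :> R.
  rewrite -big_split; apply: ler_sum => k _ /=.
  by case: (expl _); case: (_ != _); rewrite /= ?addr0 ?add0r ?lerDl.
have expl_count : visits expl h <= eps / 2 * e / b * (size h)%:R + L :> R.
  apply: le_trans (HL (size h)); apply: ler_sum => k _.
  by rewrite /expl size_takel // ltnW.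
have bsplit := ler_wpM2l (ltW b0) split_count.
have bexpl := ler_wpM2l (ltW b0) expl_count.
have bdel : b * (eps / 2 * e / b * (size h)%:R) = eps / 2 * (e * (size h)%:R).
  by field; rewrite gt_eqF.
have := ler_wpM2l (ltW eps2) (total_cost_ge h He).
rewrite mulrDr in bsplit; rewrite mulrDr bdel in bexpl.
have -> : dstar p c i - eps / 2 = dstar p c i - eps + eps / 2 by field.
rewrite mulrDl; lra.
Qed.

Section Threshold.
Context (T : R) (T0 : 0 < T).

Definition threshold_crossed : pred (@history Y U) :=
  fun h => (0 < size h)%N && crosses y0 p T ihat phi h.

Lemma crosses_gt h i : crosses y0 p T ihat phi h -> i != ihat h ->
  T * joint y0 p phi i h <= joint y0 p phi (ihat h) h.
Proof.
rewrite /crosses => + ii; set mx := \big[_/_]_(_ | _) _ => cr.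
have mxi : joint y0 p phi i h <= mx by apply: (le_bigmax_cond _ (fun j => joint y0 p phi j h)).
have mx_ge0 : 0 <= mx by apply: le_trans mxi; apply: joint_ge0.
have mx0 : 0 < mx.
  rewrite lt0r mx_ge0 andbT; apply: contraTneq cr => ->.
  by rewrite invr0 mulr0 -leNgt ltW.
rewrite ltr_pdivlMr // in cr; apply: le_trans (ltW cr).
by rewrite ler_pM2l.
Qed.

(** If all log-likelihood ratios exceed both 0 and [ln T], then [i] is the only
    maximizer of the likelihood and the threshold is crossed. *)
Lemma not_crosses i h : 0 < joint y0 p phi i h -> ~~ crosses y0 p T ihat phi h ->
  exists2 j, j != i & llr i j h <= Num.max 0 (ln T).
Proof.
move=> J ncr; apply: contrapT => H; case/negP: ncr.
have S j : j != i -> Num.max 0 (ln T) < llr i j h.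
  by move=> ji; rewrite ltNge; apply/negP => S; apply: H; exists j.
have [ML _] := hstar.
have lt_joint j : j != i -> joint y0 p phi j h < joint y0 p phi i h.
  move=> ji; rewrite (joint_llr hpos phi i j) -[X in _ < X]mulr1 ltr_pM2l //.
  rewrite -[X in _ < X]expR0 ltr_expR oppr_lt0.
  by apply: le_lt_trans (S j ji); rewrite le_max lexx.
have ih : ihat h = i.
  apply/eqP/negPn/negP => ne; have := ML h i; rewrite leNgt.
  by rewrite lt_joint.
rewrite /crosses ih; set mx := \big[_/_]_(_ | _) _.
have JT : 0 < joint y0 p phi i h / T by rewrite divr_gt0.
have mxJ : mx < joint y0 p phi i h / T.
  apply: bigmax_lt => // j ji; rewrite ltr_pdivlMr //.
  rewrite (joint_llr hpos phi i j) -mulrA -[X in _ < X]mulr1 ltr_pM2l //.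
  rewrite -[T]lnK ?posrE // -expRD -[X in _ < X]expR0 ltr_expR.
  have : ln T < llr i j h by apply: le_lt_trans (S j ji); rewrite le_max lexx orbT.
  lra.
have [j ji] := exists_other hM i.
have mx0 : 0 < mx.
  apply: (@lt_le_trans _ _ (joint y0 p phi j h)).
    by rewrite (joint_llr hpos phi i j) mulr_gt0 ?expR_gt0.
  exact: (le_bigmax_cond _ (fun j => joint y0 p phi j h)).
by rewrite ltr_pdivlMr // mulrC -ltr_pdivlMr.
Qed.

End Threshold.

(** At the last time before stopping some rival is not rejected, so the cost
    spent is at most [ln T / (dstar - eps)] up to remainders of finite mean. *)
Lemma star_cost_sum i (eps : R) : 0 < eps -> eps < dstar p c i ->
  (exists K, forall n, \sum_(k < n) Ex phi i k (fun h => (ihat h != i)%:R) <= K) ->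
  exists K, forall T, 0 < T -> forall n,
    \sum_(k < n) Ex phi i k (fun h => (alive (threshold_crossed T) h)%:R * \sum_u phi h u * c u)
      <= (Num.max 0 (ln T) + K) / (dstar p c i - eps).
Proof.
move=> eps0 epsd [Kmis HKmis].
have pack (j : 'I_M) : exists bKD : R * R * (@history Y U -> R),
    j != i -> [/\ 0 < bKD.1.1, 0 < bKD.1.2, forall h, 0 <= bKD.2 h,
      forall n, \sum_(k < n) Ex phi i k bKD.2 <= bKD.1.2 &
      forall h, (dstar p c i - eps) * total_cost h <=
        llr i j h + bKD.2 h + bKD.1.1 * visits (fun h => ihat h != i) h + bKD.1.2].
  have [->|ji] := eqVneq j i; first by exists (0, 0, fun=> 0).
  by have [b [K [D HD]]] := star_rate_deficit ji eps0; exists (b, K, D).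
have [F HF] := choice pack.
pose b j := (F j).1.1; pose K j := (F j).1.2; pose D j := (F j).2.
have [C C0 HC] := fin_ubound c.
set d := dstar p c i - eps; have d0 : 0 < d by rewrite subr_gt0.
pose mis : @history Y U -> R := visits (fun h => ihat h != i).
exists (d * C + \sum_(j | j != i) (K j + b j * Kmis + K j)) => T T0 n.
have -> : \sum_(k < n) Ex phi i k (fun h => (alive (threshold_crossed T) h)%:R * \sum_u phi h u * c u)
    = Ex phi i n (fun h => total_cost (stopped (threshold_crossed T) h)).
  rewrite (Ex_stopped hp (threshold_crossed T) i n total_cost hphi) /total_cost cum_nil add0r.
  apply: eq_bigr => k _; apply: eq_Ex => h _; congr (_ * _).
  rewrite drift_cum //; apply: eq_bigr => u _.
  by rewrite /= -mulr_suml (hp _ _ _).2 mul1r.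
set ell := Num.max 0 (ln T); have ell0 : 0 <= ell by rewrite le_max lexx.
pose rem h := \sum_(j | j != i) (\sum_(m < (size h).+1) D j (take m h) + b j * mis h + K j).
have rem_ge0 h : 0 <= rem h.
  apply: sumr_ge0 => j ji; have [b0 K0 D0 _ _] := HF j ji.
  rewrite !addr_ge0 ?sumr_ge0 ?(ltW K0) //; first by move=> m _; apply: D0.
  by rewrite mulr_ge0 ?(ltW b0) ?visits_ge0.
have before h m : 0 < joint y0 p phi i h -> (m <= size h)%N ->
    ~~ threshold_crossed T (take m h) -> d * total_cost (take m h) <= ell + rem h.
  move=> J mh; case: (posnP m) => [->|m0].
    by rewrite take0 /total_cost cum_nil mulr0 addr_ge0.
  rewrite /threshold_crossed size_takel // m0 /= => ncr.
  have Jm := joint_take_gt0 hpos m hphi J.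
  have [j ji Sj] := not_crosses T0 Jm ncr.
  have [b0 K0 D0 _ H] := HF j ji.
  apply: le_trans (H (take m h)) _; rewrite -!addrA; apply: lerD => //.
  rewrite /rem (bigD1 j) //= -!addrA.
  have rest0 : 0 <= \sum_(k | (k != i) && (k != j))
      (\sum_(m < (size h).+1) D k (take m h) + b k * mis h + K k).
    apply: sumr_ge0 => k /andP[ki _]; have [bk0 Kk0 Dk0 _ _] := HF k ki.
    rewrite !addr_ge0 ?sumr_ge0 ?(ltW Kk0) //; first by move=> l _; apply: Dk0.
    by rewrite mulr_ge0 ?(ltW bk0) ?visits_ge0.
  have mh' : (m < (size h).+1)%N by rewrite ltnS.
  apply: lerD.
    rewrite (bigD1 (Ordinal mh')) //= lerDl; apply: sumr_ge0 => l _; exact: D0.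
  apply: lerD; first by rewrite ler_pM2l // visits_take.
  by rewrite lerDl.
have stop_bound h : 0 < joint y0 p phi i h ->
    d * total_cost (stopped (threshold_crossed T) h) <= ell + d * C + rem h.
  move=> J; have [ah|nah] := boolP (alive (threshold_crossed T) h).
    rewrite stopped_alive //; have := before h (size h) J (leqnn _).
    rewrite take_size => H; apply: le_trans (H _) _.
      by have := aliveP _ _ ah _ (leqnn (size h)); rewrite take_size.
    by rewrite -addrA lerD2l lerDr mulr_ge0 // ltW.
  have [[|m] [mh -> sm ms]] := stopped_stop nah.
    by move: sm; rewrite /threshold_crossed take0.
  have := before h m J (ltnW mh) (ms m (ltnSn m)).
  case: h J mh sm ms {nah} => [|x0 h'] // J mh sm ms H.
  rewrite (take_nth x0) // {1}/total_cost cum_rcons -/(total_cost _) mulrDr.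
  have := HC (nth x0 (x0 :: h') m).2; rewrite ler_norml => /andP[_ cC].
  have := ler_wpM2l (ltW d0) cC; rewrite /=; lra.
rewrite ler_pdivlMr // mulrC -ExZ.
apply: (@le_trans _ _ (Ex phi i n (fun h => (ell + d * C) + rem h))).
  by apply: le_Ex => // h _ J; apply: stop_bound.
rewrite ExD (Ex_cst hp) // -addrA !lerD2l Ex_sum; apply: ler_sum => j ji.
have [b0 K0 D0 DK _] := HF j ji.
rewrite !ExD (Ex_cst hp) // lerD2r; apply: lerD; last first.
  by rewrite ExZ ler_pM2l // (Ex_visits y0 hp) //.
apply: le_trans (DK n.+1).
rewrite (@eq_Ex _ _ _ _ _ _ phi i n _ (fun h => \sum_(m < n.+1) D j (take m h))); last first.
  by move=> h ->.
rewrite Ex_sum; apply: ler_sum => m _.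
by rewrite (Ex_take hp i (D j) hphi) // -ltnS.
Qed.

End StarCost.

(** * Asymptotic optimality *)

Section FirstTime.
Context (P : pred nat).

Lemma first_timeP n :
  first_time P = Some n <-> P n /\ forall m, (m < n)%N -> ~~ P m.
Proof.
rewrite /first_time; case: pselect => [exP|nexP]; last first.
  by split=> // -[Pn _]; case: nexP; exists n.
case: ex_minnP => k Pk mink; split=> [[<-]|[Pn minn]].
  by split=> // m mk; apply/negP => /mink; rewrite leqNgt mk.
congr Some; apply/eqP; rewrite eqn_leq mink //= leqNgt; apply/negP => kn.
by move: (minn k kn); rewrite Pk.
Qed.

End FirstTime.

Section StarTest.
Context {R : realType} {M : nat} {Y U : finType} (y0 : Y) (u0 : U)
  (p : 'I_M -> U -> Y -> Y -> R) (c : U -> R).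
Context (hM : (1 < M)%N) (hp : forall i u yt, is_pmf (p i u yt))
  (hpos : forall i u yt y, 0 < p i u yt y) (hc : forall u, 0 < c u).
Local Notation Ex := (@Ex R M Y U y0 p).
Implicit Types (h : @history Y U) (i j : 'I_M).

Lemma error_union (t : seqtest R M Y U) i (b : R) : is_seqtest y0 p t ->
  (forall j, j != i -> (Pr (expt t) i (decides (pred1 j)) <= b%:E)%E) ->
  (Pr (expt t) i (decides (predC1 i)) <= (M.-1%:R * b)%:E)%E.
Proof.
move=> ht Hb; have [hphi hX _] := ht; have [st hst] := seqtest_stops_at ht.
apply: (Pr_decides_le hst hX) => n.
have -> : M.-1%:R * b = \sum_(j | j != i) b.
  by rewrite -[in LHS](card_ord M) -(cardC1 i) mulr_natl sumr_const.
apply: (@le_trans _ _ (\sum_(j | j != i)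
    Ex (pol t) i n (fun h => (decided t st (pred1 j) h)%:R))).
  rewrite -Ex_sum; apply: le_Ex => // h _ _.
  case: (boolP (decided t st (predC1 i) h)) => [/andP[nah ri]|_]; last first.
    by apply: sumr_ge0 => j _; apply: ler0n.
  rewrite (bigD1 (rule t (stopped st h))) //= /decided nah /= eqxx lerDl.
  by apply: sumr_ge0 => j _; apply: ler0n.
apply: ler_sum => j ji; rewrite -lee_fin; apply: le_trans (Hb j ji).
exact: Pr_decides_ge.
Qed.

Context (a : R) (qs : 'I_M -> Y -> U -> R) (ihat : @history Y U -> 'I_M)
  (phi : @policy R Y U) (X : experiment R M Y U).
Context (a1 : 1 < a) (qmax : forall i, is_maximizer p c i (qs i))
  (hstar : is_star_policy y0 p a qs ihat phi) (hX : realizes y0 p phi X).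

Local Notation t := (star_test y0 p ihat phi X).
Local Notation crossed := (threshold_crossed y0 p ihat phi).

Let hphi : is_policy phi. Proof. exact: (star_is_policy u0 qmax hstar). Qed.

Lemma star_stops_at T : stops_at (t T) (crossed T).
Proof.
move=> w n; rewrite /= first_timeP /threshold_crossed size_hist; split=> -[Pn mn]; split=> //.
  by move=> m /mn; rewrite size_hist.
by move=> m /mn; rewrite size_hist.
Qed.

Lemma star_is_seqtest T : is_seqtest y0 p (t T).
Proof.
split=> // n; exists [set h | crossed T h /\ forall m, (m < n)%N -> ~~ crossed T (take m h)] => //.
rewrite setTI; apply/seteqP; split=> w.
  move=> [cn cm]; apply: (proj2 (@star_stops_at T w n)); split=> // m mn.
  by have := cm m mn; rewrite take_hist // ltnW.
move=> /(proj1 (@star_stops_at T w n))[cn cm]; split=> // m mn.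
by rewrite take_hist ?(ltnW mn) //; apply: cm.
Qed.

(** On the event that [k] is decided, its likelihood exceeds [T] times that of
    the true hypothesis: a change of measure to [k] gives the bound. *)
Lemma star_wrong_decision T i k : 0 < T -> k != i ->
  (Pr X i (@decides _ _ _ _ (t T) (pred1 k)) <= (1 / T)%:E)%E.
Proof.
move=> T0 ki; apply: (Pr_decides_le (@star_stops_at T) hX) => n.
pose F h : R := (crossed T h && (ihat h == k))%:R.
have -> : Ex (pol (t T)) i n (fun h => (decided (t T) (crossed T) (pred1 k) h)%:R) =
    Ex phi i n (fun h => F (stopped (crossed T) h)).
  by apply: eq_Ex => h _; rewrite /F st_stopped.
rewrite (Ex_stopped_llr hp hpos (crossed T) k i) // -[X in _ <= X](Ex_cst (y0 := y0) hp k n (1 / T) hphi).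
apply: le_Ex => // h sh J; set g := stopped _ h.
have Jg : 0 < joint y0 p phi k g.
  exact: joint_take_gt0.
rewrite /F; case: (boolP (_ && _)) => [/andP[/andP[_ cr] /eqP ihk]|_] /=; last first.
  by rewrite mulr0 divr_ge0 // ltW.
rewrite mulr1 ler_pdivlMr // mulrC.
have := crosses_gt u0 hpos qmax hstar T0 cr (i := i).
rewrite ihk eq_sym => /(_ ki); rewrite (joint_llr hpos phi k i g).
by rewrite mulrCA -[X in _ <= X -> _]mulr1 ler_pM2l.
Qed.

Lemma star_Pmax_le T : 0 < T -> (Pmax (t T) <= (M.-1%:R / T)%:E)%E.
Proof.
move=> T0; apply: bigmax_le => [|i _].
  by rewrite lee_fin divr_ge0 ?ler0n // ltW.
have := @error_union (t T) i (1 / T) (star_is_seqtest T)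
  (fun j ji => star_wrong_decision T0 ji).
by rewrite mul1r.
Qed.

Lemma star_cost_le i (eps : R) : 0 < eps -> eps < dstar p c i ->
  (exists K, forall n, \sum_(k < n) Ex phi i k (fun h => (ihat h != i)%:R) <= K) ->
  exists K, forall T, 0 < T ->
    (expected_cost c (t T) i <= ((Num.max 0 (ln T) + K) / (dstar p c i - eps))%:E)%E.
Proof.
move=> eps0 epsd mis.
have [K HK] := star_cost_sum u0 hM hp hpos hc a1 qmax hstar eps0 epsd mis.
exists K => T T0; apply: (expected_cost_le hp hpos hc (@star_stops_at T) hphi hX) => n.
exact: HK.
Qed.

(** The expected cost is finite and every control costs at least a fixed amount. *)
Lemma star_terminates i T : 0 < T -> 0 < dstar p c i ->
  (exists K, forall n, \sum_(k < n) Ex phi i k (fun h => (ihat h != i)%:R) <= K) ->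
  Pr X i [set w | @stop _ _ _ _ (t T) w = None] = 0%E.
Proof.
move=> T0 d0 mis; have d2 : 0 < dstar p c i / 2 by rewrite divr_gt0.
have dd : dstar p c i / 2 < dstar p c i by lra.
have [K HK] := star_cost_le d2 dd mis.
have [K' K'0 HK'] := survival_le hp hpos hc (@star_stops_at T) hphi hX (HK T T0).
have mE : measurable [set w | @stop _ _ _ _ (t T) w = None].
  rewrite (_ : [set w | _] = \bigcap_n [set w | alive (crossed T) (hist n w)]).
    by apply: bigcapT_measurable => n; apply: (measurable_hist hX n (fun h => alive (crossed T) h)).
  apply/seteqP; split=> [w sw n _|w H].
    by rewrite /mkset (alive_hist (@star_stops_at T)) sw.
  rewrite /mkset; case sw : (@stop _ _ _ _ (t T) w) => [n|] //.
  have : alive (crossed T) (@hist _ _ _ _ (expt (t T)) n w) by exact: H.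
  by rewrite (alive_hist (@star_stops_at T)) sw /= ltnn.
apply/eqP; rewrite eq_le measure_ge0 andbT.
have fin : Pr X i [set w | @stop _ _ _ _ (t T) w = None] \is a fin_num.
  exact: fin_num_measure.
rewrite -(fineK fin) lee_fin; apply: (@le_of_harmonic _ _ K') => n.
rewrite add0r -lee_fin (fineK fin).
apply: le_trans (_ : (Ex phi i n (fun h => (alive (crossed T) h)%:R))%:E <= _)%E; last first.
  by rewrite lee_fin.
rewrite -(Pr_hist hX); apply: le_measure; rewrite ?inE //.
  exact: (measurable_hist hX n (fun h => alive (crossed T) h)).
by move=> w sw /=; rewrite (alive_hist (@star_stops_at T)) sw.
Qed.

End StarTest.

Section Asymptotics.
Context {R : realType}.
Implicit Types f g : R -> \bar R.

Lemma near_pinfty (A : R) : \forall T \near +oo, A < T.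
Proof. by apply: nbhs_pinfty_gt; apply: num_real. Qed.

Lemma near_pinfty_ln (A : R) : \forall T \near +oo, A < ln T.
Proof.
apply: filterS (near_pinfty (expR A)) => T AT.
have T0 : 0 < T by apply: lt_trans AT; apply: expR_gt0.
by rewrite -[A]expRK ltr_ln ?posrE ?expR_gt0.
Qed.

Lemma near_pinfty_le (A : R) : \forall T \near +oo, A <= T.
Proof. by apply: filterS (near_pinfty A) => T /ltW. Qed.

Lemma near_pinfty_ln_le (A : R) : \forall T \near +oo, A <= ln T.
Proof. by apply: filterS (near_pinfty_ln A) => T /ltW. Qed.

Lemma asym_eq_infinite f g : (\forall T \near +oo, f T = +oo%E) ->
  (\forall T \near +oo, g T = +oo%E) -> asym_eq +oo f g.
Proof.
move=> fy gy; exists (fun=> 0); first exact: cvg_cst.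
by apply: filterS2 fy gy => T -> ->; rewrite addr0 mule1.
Qed.

(** Both functions are squeezed between multiples of [ln T / d] close to 1. *)
Lemma asym_eq_sandwich f g (d : R) : 0 < d ->
  (forall eps, 0 < eps -> eps < 1 / 2 -> \forall T \near +oo,
     exists F G : R, [/\ f T = F%:E, g T = G%:E, d * F <= (1 + eps) * ln T,
       (1 - eps) * ln T <= d * G & (1 - eps) * G <= F]) ->
  asym_eq +oo f g.
Proof.
move=> d0 H; exists (fun T => fine (f T) / fine (g T) - 1).
  apply/cvgr0Pnorm_lt => eta eta0.
  pose eps := Num.min (1 / 4) (eta / 8).
  have eps0 : 0 < eps by rewrite lt_min !divr_gt0.
  have eps1 : eps <= 1 / 4 by rewrite ge_min lexx.
  have eps2 : eps <= eta / 8 by rewrite ge_min lexx orbT.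
  have epsh : eps < 1 / 2 by lra.
  apply: filterS2 (H eps eps0 epsh) (near_pinfty_ln 0) => T [F [G [-> -> dF dG GF]]] L0.
  have G0 : 0 < G.
    rewrite -(pmulr_rgt0 _ d0); apply: lt_le_trans dG; rewrite mulr_gt0 //; lra.
  have up : F <= (1 + 4 * eps) * G.
    rewrite -(ler_pM2l d0); apply: le_trans dF _; rewrite mulrCA.
    apply: (@le_trans _ _ ((1 + 4 * eps) * ((1 - eps) * ln T))); last first.
      by rewrite ler_pM2l //; lra.
    rewrite mulrA ler_pM2r //.
    have : 0 <= eps * (1 / 4 - eps) by rewrite mulr_ge0 //; lra.
    lra.
  rewrite /= ltr_norml; apply/andP; split.
    rewrite ltrBrDr ltr_pdivlMr //.
    apply: lt_le_trans GF; rewrite ltr_pM2r //; lra.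
  rewrite ltrBlDr ltr_pdivrMr //.
  apply: le_lt_trans up _; rewrite ltr_pM2r //; lra.
have q0 : 0 < (1 / 4 : R) by lra.
have qh : (1 / 4 : R) < 1 / 2 by lra.
apply: filterS2 (H _ q0 qh) (near_pinfty_ln 0) => T [F [G [-> -> dF dG GF]]] L0 /=.
have G0 : 0 < G.
  rewrite -(pmulr_rgt0 _ d0); apply: lt_le_trans dG; rewrite mulr_gt0 //; lra.
by rewrite -EFinM addrCA subrr addr0 mulrCA divff ?mulr1 // gt_eqF.
Qed.

End Asymptotics.

Section Optimality.
Context {R : realType} {M : nat} {Y U : finType} (y0 : Y) (u0 : U)
  (p : 'I_M -> U -> Y -> Y -> R) (c : U -> R).
Context (hM : (1 < M)%N) (hp : forall i u yt, is_pmf (p i u yt))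
  (hpos : forall i u yt y, 0 < p i u yt y) (hc : forall u, 0 < c u).
Context (a : R) (qs : 'I_M -> Y -> U -> R) (ihat : @history Y U -> 'I_M)
  (phi : @policy R Y U) (X : experiment R M Y U).
Context (a1 : 1 < a) (qmax : forall i, is_maximizer p c i (qs i))
  (hstar : is_star_policy y0 p a qs ihat phi) (hX : realizes y0 p phi X).
Implicit Types (i j : 'I_M).

Local Notation t := (star_test y0 p ihat phi X).
Let tseq T : is_seqtest y0 p (t T) := star_is_seqtest u0 qmax hstar hX T.

Let m : R := M.-1%:R.
Let m1 : 1 <= m. Proof. by rewrite /m ler1n -ltnS prednK // ltnW. Qed.

(** Both classes of competing tests enter the bounds only through these estimates
    of an error probability by [b] and of a risk by [x]. *)
Definition reliable i (b x : R) (t' : seqtest R M Y U) : Prop :=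
  [/\ is_seqtest y0 p t', (Pr (expt t') i (decides (predC1 i)) <= b%:E)%E &
    (risk t' i <= x%:E)%E].

Lemma class_Pmax_reliable i (P : R) t' :
  class_Pmax y0 p P%:E t' -> reliable i (m * P) P t'.
Proof.
move=> [ht' tP]; have P0 : 0 <= P by rewrite -lee_fin (le_trans (Pmax_ge0 hM t')).
split=> //; last exact: le_trans (risk_le_Pmax hM i ht') tP.
apply: le_trans (Pr_error_le_Pmax t' i) _; apply: le_trans tP _.
by rewrite lee_fin ler_peMl.
Qed.

Lemma class_risk_reliable T i (P x : R) t' : Pmax (t T) = P%:E -> risk (t T) i = x%:E ->
  class_risk y0 p (risk (t T)) t' -> reliable i (m * P) x t'.
Proof.
move=> PE rE [ht' tr]; split=> //; last by rewrite -rE.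
apply: (error_union hpos ht') => j ji.
have ij : i != j by rewrite eq_sym.
apply: le_trans (Pr_decision_le_risk t' ij) _; apply: le_trans (tr j) _.
by rewrite -PE; apply: (risk_le_Pmax hM).
Qed.

Lemma star_Pmax_real T : 0 < T ->
  exists2 P : R, Pmax (t T) = P%:E & 0 <= P <= m / T.
Proof.
move=> T0; have := star_Pmax_le u0 hp hpos qmax hstar hX T0.
have := Pmax_ge0 hM (t T); case: (Pmax (t T)) => [P| |] //.
by rewrite !lee_fin => P0 PT; exists P => //; rewrite P0.
Qed.

(** Everything that is needed about large thresholds at once: the cost [F] of
    the threshold test is at most [(1 + eps) ln T / dstar], whereas a test of
    risk [r] costs at least [(1 - eps) (- ln r) / dstar], and [- ln r] is at least
    [(1 - eps) ln T] for [r] up to [P]. *)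
Lemma star_large_threshold i (eps : R) : 0 < dstar p c i ->
  (exists K, forall n, \sum_(k < n) Ex (y0 := y0) (p := p) phi i k (fun h => (ihat h != i)%:R) <= K) ->
  0 < eps -> eps < 1 / 2 -> \forall T \near +oo, exists F P x : R,
    [/\ expected_cost c (t T) i = F%:E, Pmax (t T) = P%:E, risk (t T) i = x%:E,
      dstar p c i * F <= (1 + eps) * ln T & 0 < x <= P] /\
    [/\ 0 < ln T, (1 - eps) * ln T <= - ln P & forall t' r, 0 < r -> r <= P ->
      reliable i (m * P) r t' ->
      (((1 - eps) * - ln r / dstar p c i)%:E <= expected_cost c t' i)%E].
Proof.
move=> d0 mis eps0 eps1; set d := dstar p c i.
pose eps' := d * (eps / 4); have eps'0 : 0 < eps' by rewrite mulr_gt0 // divr_gt0.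
have eps'd : eps' < d by rewrite /eps' -[X in _ < X]mulr1 ltr_pM2l //; lra.
have [K HK] := star_cost_le u0 hM hp hpos hc a1 qmax hstar hX eps'0 eps'd mis.
have [K0 K00 HK0] := cost_lower_bound y0 u0 hM hp hpos hc d0.
have m0 : 0 < m by apply: lt_le_trans m1.
near=> T.
have T1 : 1 < T by near: T; apply: near_pinfty.
have T0 : 0 < T by apply: lt_trans T1.
have L0 : 0 < ln T by rewrite ln_gt0.
have [P PE /andP[P0 PT]] := star_Pmax_real T0.
have mP : m * P <= eps / 2.
  apply: le_trans (ler_wpM2l (ltW m0) PT) _; rewrite mulrA ler_pdivrMr // [_ * T]mulrC.
  rewrite -ler_pdivrMr; last by rewrite divr_gt0.
  near: T.
  exact: near_pinfty_le.
have Ph : P <= eps / 2 by apply: le_trans mP; rewrite ler_peMl.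
have F_le := HK T T0; have F_ge0 := expected_cost_ge0 hc (t T) i.
rewrite max_r ?(ltW L0) // in F_le.
have x_ge0 := risk_ge0 hM (t T) i; have x_le := risk_le_Pmax hM i (tseq T).
have err := Pr_error_le_Pmax (t T) i; rewrite PE in err x_le.
have P2 : P < 1 / 2 by lra.
case FE : (expected_cost c (t T) i) F_ge0 F_le => [F| |] // F0 F_le.
rewrite lee_fin in F_le.
case xE : (risk (t T) i) x_ge0 x_le => [x| |] //; rewrite !lee_fin => x_ge0 xP.
have x0 : 0 < x.
  rewrite lt0r x_ge0 andbT; apply/eqP => x_eq0.
  have := expected_cost_infinite u0 hM hp hpos hc (tseq T) err P2.
  by rewrite FE xE x_eq0 => /(_ (or_introl erefl)).
have Pgt0 : 0 < P by apply: lt_le_trans xP.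
exists F, P, x; split; first split => //.
- apply: (@le_trans _ _ (d * ((ln T + K) / (d - eps')))); first by rewrite ler_pM2l.
  have -> : d * ((ln T + K) / (d - eps')) = (ln T + K) / (1 - eps / 4).
    have ? : d != 0 by rewrite gt_eqF.
    have -> : d - eps' = d * (1 - eps / 4) by rewrite /eps'; ring.
    by rewrite mulrCA invfM; congr (_ * _); rewrite mulrA divff // mul1r.
  rewrite ler_pdivrMr; last lra.
  have K_le : K <= eps / 4 * ln T.
    rewrite mulrC -ler_pdivrMr; last by rewrite divr_gt0.
    near: T.
    exact: near_pinfty_ln_le.
  have : 0 <= eps * (1 - eps) * ln T by rewrite !mulr_ge0 //; lra.
  have : 0 <= eps * ln T by rewrite mulr_ge0 // ltW.
  lra.
- by rewrite x0.
have lnP : (1 - eps) * ln T <= - ln P.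
  have : ln P <= ln m - ln T.
    by rewrite -ln_div ?posrE // ler_ln ?posrE // divr_gt0.
  have : ln m <= eps * ln T.
    rewrite mulrC -ler_pdivrMr; last exact: eps0.
    near: T.
    exact: near_pinfty_ln_le.
  lra.
split=> // t' r r0 rP [ht' err' risk'].
have r1 : r <= 1 by lra.
apply: le_trans (HK0 t' ht' (m * P) r r0 r1 err' risk').
rewrite lee_fin ler_pM2r ?invr_gt0 //.
have Lr : - ln P <= - ln r by rewrite lerN2 ler_ln.
have K0_le : K0 <= eps / 2 * ((1 - eps) * ln T).
  rewrite mulrA mulrC -ler_pdivrMr; last by rewrite mulr_gt0 ?divr_gt0 //; lra.
  near: T; exact: near_pinfty_ln_le.
have Lr0 : 0 <= - ln r.
  apply: le_trans Lr; apply: le_trans lnP; rewrite mulr_ge0 //; lra.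
have h1 := ler_wpM2r Lr0 mP.
have h2 : eps / 2 * ((1 - eps) * ln T) <= eps / 2 * - ln r.
  by rewrite ler_pM2l ?divr_gt0 //; apply: le_trans Lr.
lra.
Unshelve. all: by end_near.
Qed.

Lemma lne_ratio (d x : R) : 0 < d -> 0 < x ->
  (- lne x%:E / d%:E)%E = (- ln x / d)%:E.
Proof. by move=> d0 x0; rewrite lne_EFin // inver gt_eqF. Qed.

Lemma star_optimal i :
  (0 < dstar p c i -> exists K, forall n,
    \sum_(k < n) Ex (y0 := y0) (p := p) phi i k (fun h => (ihat h != i)%:R) <= K) ->
  [/\ asym_eq +oo (fun T => expected_cost c (t T) i)
        (fun T => - lne (Pmax (t T)) / (dstar p c i)%:E)%E,
      asym_eq +oo (fun T => expected_cost c (t T) i)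
        (fun T => inf_cost c i (class_Pmax y0 p (Pmax (t T)))),
      asym_eq +oo (fun T => expected_cost c (t T) i)
        (fun T => - lne (risk (t T) i) / (dstar p c i)%:E)%E &
      asym_eq +oo (fun T => expected_cost c (t T) i)
        (fun T => inf_cost c i (class_risk y0 p (risk (t T))))].
Proof.
move=> mis; have d_ge0 := dstar_ge0 y0 u0 hM hp hpos hc i.
have [d0|d_neq0] := eqVneq (dstar p c i) 0.
  have small : \forall T \near +oo, 0 < T /\ m * (m / T) < 1 / 2.
    apply: filterS2 (near_pinfty 0) (near_pinfty (m * m / (1 / 2))) => T T0 mT; split=> //.
    by rewrite mulrA ltr_pdivrMr // [_ * T]mulrC -ltr_pdivrMr //; lra.
  have reliable_infinite (P x : R) t' : m * P < 1 / 2 -> 0 <= P -> x <= P -> reliable i (m * P) x t' ->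
      expected_cost c t' i = +oo%E.
    move=> mP P0 xP [ht' err' r']; apply: (expected_cost_infinite u0 hM hp hpos hc ht' err' mP).
    right; split=> //; apply: le_trans r' _; rewrite lee_fin; apply: le_trans xP _.
    by rewrite ler_peMl.
  have facts : \forall T \near +oo, exists P x : R, [/\ Pmax (t T) = P%:E, risk (t T) i = x%:E,
      m * P < 1 / 2, 0 <= P & 0 <= x <= P].
    apply: filterS small => T [T0 mT].
    have [P PE /andP[P0 PT]] := star_Pmax_real T0.
    have := risk_ge0 hM (t T) i; have := risk_le_Pmax hM i (tseq T); rewrite PE.
    case xE : (risk (t T) i) => [x| |] //; rewrite !lee_fin => xP x0.
    exists P, x; split=> //; last by rewrite x0.
    by apply: le_lt_trans mT; rewrite ler_pM2l // (lt_le_trans _ m1).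
  have cost_oo : \forall T \near +oo, expected_cost c (t T) i = +oo%E.
    apply: filterS facts => T [P [x [PE xE mP P0 /andP[x0 xP]]]].
    apply: (reliable_infinite P P (t T) mP P0 (lexx P)); apply: class_Pmax_reliable.
    by split; [exact: tseq | rewrite PE].
  have ratio_oo (x : R) : x < 1 -> (- lne x%:E / (dstar p c i)%:E)%E = +oo%E.
    by move=> x1; rewrite d0 inve0 gt0_muley // oppe_gt0 lne_lt0 lte_fin.
  split; apply: asym_eq_infinite => //; apply: filterS facts => T [P [x [PE xE mP P0 /andP[x0 xP]]]].
  - by rewrite PE ratio_oo //; have : P <= m * P; [rewrite ler_peMl | lra].
  - apply/ereal_inf_pinfty => _ [t' Ct' ->]; rewrite PE in Ct'.
    exact: (reliable_infinite P P t' mP P0 (lexx P) (class_Pmax_reliable i Ct')).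
  - by rewrite xE ratio_oo //; have : P <= m * P; [rewrite ler_peMl | lra].
  - apply/ereal_inf_pinfty => _ [t' Ct' ->].
    exact: (reliable_infinite P x t' mP P0 xP (class_risk_reliable PE xE Ct')).
have d0 : 0 < dstar p c i by rewrite lt0r d_neq0.
have large := fun eps => star_large_threshold d0 (mis d0) (eps := eps).
have ratio (g : R -> \bar R) :
    (forall T F P x eps, expected_cost c (t T) i = F%:E -> Pmax (t T) = P%:E ->
       risk (t T) i = x%:E -> 0 < x -> x <= P -> 0 < eps -> eps < 1 / 2 -> 0 < ln T ->
       (1 - eps) * ln T <= - ln P ->
       (forall t' r, 0 < r -> r <= P -> reliable i (m * P) r t' ->
         (((1 - eps) * - ln r / dstar p c i)%:E <= expected_cost c t' i)%E) ->
       exists G, [/\ g T = G%:E, (1 - eps) * ((1 - eps) * ln T) <= dstar p c i * G &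
         (1 - eps) * G <= F]) ->
    asym_eq +oo (fun T => expected_cost c (t T) i) g.
  move=> H; apply: (asym_eq_sandwich d0) => eps eps0 eps1.
  have e20 : 0 < eps / 2 by rewrite divr_gt0.
  have e21 : eps / 2 < 1 / 2 by lra.
  apply: filterS (large _ e20 e21) => T [F [P [x [[FE PE xE dF /andP[x0 xP]] [L0 LP lb]]]]].
  have [G [gG dG GF]] := H T F P x _ FE PE xE x0 xP e20 e21 L0 LP lb.
  have dG0 : 0 <= dstar p c i * G.
    by apply: le_trans dG; rewrite !mulr_ge0 //; lra.
  have G0 : 0 <= G by rewrite -(pmulr_rge0 _ d0).
  exists F, G; split=> //.
  - by apply: le_trans dF _; rewrite ler_pM2r //; lra.
  - apply: le_trans dG; rewrite mulrA ler_pM2r //.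
    have : 0 <= eps * eps by rewrite mulr_ge0 // ltW.
    lra.
  - by apply: le_trans GF; rewrite ler_wpM2r //; lra.
have log_ratio T eps (F P x r : R) : expected_cost c (t T) i = F%:E ->
    0 < r -> r <= P -> 0 < eps -> eps < 1 / 2 -> 0 < ln T -> (1 - eps) * ln T <= - ln P ->
    reliable i (m * P) r (t T) ->
    (forall t' r, 0 < r -> r <= P -> reliable i (m * P) r t' ->
      (((1 - eps) * - ln r / dstar p c i)%:E <= expected_cost c t' i)%E) ->
    exists G, [/\ (- lne r%:E / (dstar p c i)%:E)%E = G%:E,
      (1 - eps) * ((1 - eps) * ln T) <= dstar p c i * G & (1 - eps) * G <= F].
  move=> FE r0 rP eps0 eps1 L0 LP bt lb; exists (- ln r / dstar p c i).
  have Lr : - ln P <= - ln r by rewrite lerN2 ler_ln // posrE (lt_le_trans r0).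
  split; first exact: lne_ratio.
    rewrite [dstar p c i * _]mulrC divfK //; apply: le_trans Lr; apply: le_trans LP.
    by rewrite ler_piMl //; [rewrite mulr_ge0 //; lra | lra].
  by rewrite mulrA -lee_fin -FE; apply: lb.
have inf_ratio T eps (F P x r : R) (C : seqtest R M Y U -> Prop) :
    expected_cost c (t T) i = F%:E -> C (t T) -> (forall t', C t' -> reliable i (m * P) r t') ->
    0 < r -> r <= P -> 0 < eps -> eps < 1 / 2 -> 0 < ln T -> (1 - eps) * ln T <= - ln P ->
    (forall t' r, 0 < r -> r <= P -> reliable i (m * P) r t' ->
      (((1 - eps) * - ln r / dstar p c i)%:E <= expected_cost c t' i)%E) ->
    exists G, [/\ inf_cost c i C = G%:E,
      (1 - eps) * ((1 - eps) * ln T) <= dstar p c i * G & (1 - eps) * G <= F].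
  move=> FE Ct Cb r0 rP eps0 eps1 L0 LP lb.
  have Lr : - ln P <= - ln r by rewrite lerN2 ler_ln // posrE (lt_le_trans r0).
  have ub : (inf_cost c i C <= F%:E)%E by rewrite -FE; apply: ereal_inf_lbound; exists (t T).
  have lb' : (((1 - eps) * - ln r / dstar p c i)%:E <= inf_cost c i C)%E.
    by apply/ereal_infP => _ [t' Ct' ->]; apply: lb => //; apply: Cb.
  have Lr0 : 0 <= - ln r by apply: le_trans Lr; apply: le_trans LP; rewrite mulr_ge0 //; lra.
  case: (inf_cost c i C) ub lb' => [G| |] //; rewrite !lee_fin => GF.
  rewrite ler_pdivrMr // => lbG; exists G; split=> //.
    rewrite [dstar p c i * G]mulrC; apply: le_trans lbG; rewrite ler_pM2l; last lra.
    exact: le_trans LP Lr.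
  apply: le_trans GF; rewrite ler_piMl //; last lra.
  rewrite -(pmulr_lge0 _ d0); apply: le_trans lbG; rewrite mulr_ge0 //; lra.
have star_in_Pmax T P : Pmax (t T) = P%:E -> class_Pmax y0 p P%:E (t T).
  by move=> PE; split; [exact: tseq | rewrite PE].
have star_in_risk T : class_risk y0 p (risk (t T)) (t T) by split; [exact: tseq|].
split; apply: ratio => T F P x eps FE PE xE x0 xP eps0 eps1 L0 LP lb.
- rewrite PE; apply: (log_ratio T eps F P x P) => //; first exact: lt_le_trans xP.
  by apply: class_Pmax_reliable; apply: star_in_Pmax.
- rewrite PE; apply: (inf_ratio T eps F P x P) => //; first exact: star_in_Pmax.
    by move=> t'; apply: class_Pmax_reliable.
  exact: lt_le_trans xP.
- rewrite xE; apply: (log_ratio T eps F P x x) => //.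
  exact: (class_risk_reliable PE xE (star_in_risk T)).
- apply: (inf_ratio T eps F P x x) => // t' Ct'.
  exact: (class_risk_reliable PE xE Ct').
Qed.

End Optimality.
Theorem theorem5p1 (R : realType) (M : nat) (Y U : finType) (y0 : Y)
    (p : 'I_M -> U -> Y -> Y -> R) (c : U -> R)
    (hM : (1 < M)%N)
    (hp : forall i u yt, is_pmf (p i u yt))
    (hpos : forall i u yt y, 0 < p i u yt y)
    (hc : forall u, 0 < c u) :
  (* converse *)
  (forall t : nat -> seqtest R M Y U,
      (forall n, is_seqtest y0 p (t n)) ->
      Pmax (t n) @[n --> \oo] --> 0%E ->
      forall i : 'I_M,
        exists e1 e2 : nat -> R,
          [/\ e1 @ \oo --> (0 : R), e2 @ \oo --> (0 : R) &
              \forall n \near \oo,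
                (expected_cost c (t n) i >=
                   - lne (risk (t n) i) / (dstar p c i)%:E * (1 + e1 n)%:E)%E /\
                (- lne (risk (t n) i) / (dstar p c i)%:E * (1 + e1 n)%:E >=
                   - lne (Pmax (t n)) / (dstar p c i)%:E * (1 + e2 n)%:E)%E]) /\
  (* achievability *)
  (exists2 a0 : R, 1 < a0 &
     forall (a : R), 1 < a -> a < a0 ->
     forall (qs : 'I_M -> Y -> U -> R) (ihat : seq (Y * U) -> 'I_M)
            (phi : seq (Y * U) -> U -> R) (X : experiment R M Y U),
       (forall i, is_maximizer p c i (qs i)) ->
       is_star_policy y0 p a qs ihat phi ->
       realizes y0 p phi X ->
       let t := star_test y0 p ihat phi X in
       [/\ forall T, 0 < T -> (Pmax (t T) <= (M.-1%:R / T)%:E)%E,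
           forall i T, 0 < T -> 0 < dstar p c i ->
             Pr X i [set w | @stop _ _ _ _ (t T) w = None] = 0%E &
           forall i : 'I_M,
             [/\ asym_eq +oo (fun T => expected_cost c (t T) i)
                   (fun T => - lne (Pmax (t T)) / (dstar p c i)%:E)%E,
                 asym_eq +oo (fun T => expected_cost c (t T) i)
                   (fun T => inf_cost c i (class_Pmax y0 p (Pmax (t T)))),
                 asym_eq +oo (fun T => expected_cost c (t T) i)
                   (fun T => - lne (risk (t T) i) / (dstar p c i)%:E)%E &
                 asym_eq +oo (fun T => expected_cost c (t T) i)
                   (fun T => inf_cost c i (class_risk y0 p (risk (t T))))]]).
Proof.
split=> [t ht P0 i|].
  have [u0 _] : exists u0 : U, True.
    apply: contrapT => nU; have [/(_ [::])[_]] := ht 0%N.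
    rewrite big1 => [/esym/eqP|u _]; first by rewrite oner_eq0.
    by case: nU; exists u.
  have [e ecv H] := converse u0 hM hp hpos hc ht P0 i.
  by exists e, e; split.
have [U0|nU] := pselect (exists u0 : U, True); last first.
  exists 2 => [|a a1 a2 qs ihat phi X qmax]; first by lra.
  have [/(_ y0)[_]] := qmax (Ordinal hM).
  rewrite big1 => [/esym/eqP|u _]; first by rewrite oner_eq0.
  by case: nU; exists u.
have [u0 _] := U0.
have [a0 a01 mis] := misestimation_sum y0 u0 hp hpos.
exists a0 => // a a1 aa qs ihat phi X qmax hstar hX t.
have misi i : 0 < dstar p c i -> exists K, forall n,
    \sum_(k < n) Ex (y0 := y0) (p := p) phi i k (fun h => (ihat h != i)%:R) <= K.
  move=> d0; apply: (mis a a1 aa); first exact: (star_is_policy u0 qmax hstar).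
  - by have [] := hstar.
  - by move=> h; apply: (star_exploration hstar).
  - by move=> j; apply: (dstar_gt0_distinct y0 hM hp hpos hc (qmax i) d0).
split=> [T T0|i T T0 d0|i].
- exact: (star_Pmax_le u0 hp hpos qmax hstar hX).
- exact: (star_terminates u0 hM hp hpos hc a1 qmax hstar hX T0 d0 (misi i d0)).
- exact: (star_optimal u0 hM hp hpos hc a1 qmax hstar hX (misi i)).
Qed.
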